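(* Let $(M,g)$ be a compact Riemannian manifold without boundary, $\mu$ a real constant, and $v$ a (time-independent) Killing vector field on $M$. Let $(u,p)$ be a (time-dependent) vector field and function on $M$ solving the linearized Navier–Stokes system \[ u_t+\nabla_u v+\nabla_v u-\mu\, Lu+\mathsf{grad}(p)=0,\qquad \mathsf{div}(u)=0 . \] Then \[ (\hat u,\hat p)=\Big([u,v],\,-g\big(\mathsf{grad}(p),v\big)\Big) \] is also a solution of the same system, i.e. $\hat u_t+\nabla_{\hat u} v+\nabla_v \hat u-\mu L\hat u+\mathsf{grad}(\hat p)=0$ and $\mathsf{div}(\hat u)=0$.
   Context: All fields are smooth. $\nabla$ is the Levi-Civita connection, $[u,v]=\nabla_u v-\nabla_v u$ is the Lie bracket, $\mathsf{grad}(p)=g^{ij}p_{;j}$, $\mathsf{div}(u)=u^i_{;i}$. In $u^k_{;ij}$ the rightmost index is the last covariant derivative taken. $Lu=\mathsf{div}(Su)$ with $(Su)^{kj}=g^{ki}u^j_{;i}+g^{ij}u^k_{;i}$, i.e. $(Lu)^j=g^{ki}u^j_{;ik}+g^{ij}u^k_{;ik}$. A vector field $v$ is Killing if $Sv=0$, equivalently $g(\nabla_X v,Y)+g(\nabla_Y v,X)=0$ for all $X,Y$. *)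

(* Defs.v *)
From HB Require Import structures.
From mathcomp Require Import all_boot all_order all_algebra.
From mathcomp Require Import all_classical all_reals all_analysis.

Set Implicit Arguments.
Unset Strict Implicit.
Unset Printing Implicit Defensive.

Import Order.TTheory GRing.Theory Num.Theory.
Import numFieldNormedType.Exports.

Local Open Scope classical_set_scope.
Local Open Scope ring_scope.

(* A smooth manifold is a space with a smooth atlas; a
   tensor field is the family of its component functions in all charts, subject
   to the usual transformation law.  Component functions are total functions on
   R^n; their values outside of the image of the chart are irrelevant. *)

(* C^k regularity on an open subset U of a finite-dimensional space V (all
   derivatives at points of U then only depend on f on U). *)
Fixpoint Ck_on (R : realType) (V W : normedModType R) (U : set V) (k : nat)
    (f : V -> W) : Prop :=
  if k is k'.+1 then
    (forall x, U x -> differentiable f x) /\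
    (forall w : V, Ck_on U k' (fun x => 'D_w f x : W))
  else forall x, U x -> {for x, continuous f}.

Definition smooth_on (R : realType) (V W : normedModType R) (U : set V)
    (f : V -> W) : Prop := forall k, Ck_on U k f.

(* Every chart is onto an open subset of R^n: no boundary.  Second countability
   is not required, since it is automatic for a compact M. *)
Record smooth_atlas (R : realType) (n : nat) (M : topologicalType) :=
  SmoothAtlas {
  chart_idx :> Type;
  dom : chart_idx -> set M;
  cod : chart_idx -> set 'rV[R]_n;
  chart : chart_idx -> M -> 'rV[R]_n;
  param : chart_idx -> 'rV[R]_n -> M;
  dom_open : forall i, open (dom i);
  cod_open : forall i, open (cod i);
  chart_cod : forall i x, dom i x -> cod i (chart i x);
  param_dom : forall i y, cod i y -> dom i (param i y);
  chartK : forall i x, dom i x -> param i (chart i x) = x;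
  paramK : forall i y, cod i y -> chart i (param i y) = y;
  chart_continuous : forall i, {within dom i, continuous (chart i)};
  param_continuous : forall i, {within cod i, continuous (param i)};
  dom_cover : forall x, exists i, dom i x;
  transition_smooth : forall i j,
    smooth_on (cod i `&` param i @^-1` dom j) (chart j \o param i)
}.

Definition transition R n M (A : @smooth_atlas R n M) (i j : A) :
  'rV[R]_n -> 'rV[R]_n := chart j \o param i.

Definition chart_at R n M (A : @smooth_atlas R n M) (x : M) : A :=
  projT1 (cid (dom_cover A x)).

(* Tensor calculus in one coordinate system.  G is the matrix (g_ij); a vector
   field is the row of its components. *)
Section Coordinates.
Context {R : realType} {n : nat}.
Implicit Types (G : 'rV[R]_n -> 'M[R]_n) (u w : 'rV[R]_n -> 'rV[R]_n).
Implicit Types (p : 'rV[R]_n -> R) (B : 'rV[R]_n -> 'M[R]_n) (y : 'rV[R]_n).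

Definition pderiv (k : 'I_n) p y : R := 'D_(delta_mx 0 k) p y.

(* g^{ij} *)
Definition ginv G y : 'M[R]_n := invmx (G y).

(* Gamma^k_{ij} of the Levi-Civita connection *)
Definition christoffel G (k i j : 'I_n) y : R :=
  2^-1 * \sum_l ginv G y k l *
    (pderiv i (fun z => G z j l) y + pderiv j (fun z => G z i l) y
     - pderiv l (fun z => G z i j) y).

(* u^k_{;i} *)
Definition cov G u (k i : 'I_n) y : R :=
  pderiv i (fun z => u z 0 k) y + \sum_l christoffel G k i l y * u y 0 l.

(* nabla_w u *)
Definition nabla G w u y : 'rV[R]_n := \row_k \sum_i w y 0 i * cov G u k i y.

Definition grad G p y : 'rV[R]_n := \row_i \sum_j ginv G y i j * pderiv j p y.

Definition divergence G u y : R := \sum_i cov G u i i y.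

(* (Su)^{kj} = g^{ki} u^j_{;i} + g^{ij} u^k_{;i} *)
Definition deform G u y : 'M[R]_n :=
  \matrix_(k, j) \sum_i (ginv G y k i * cov G u j i y
                         + ginv G y i j * cov G u k i y).

(* B^{kj}_{;k} for a twice contravariant tensor B *)
Definition div2 G B y : 'rV[R]_n :=
  \row_j \sum_k (pderiv k (fun z => B z k j) y
    + \sum_l (christoffel G k k l y * B y l j + christoffel G j k l y * B y k l)).

Definition Lop G u : 'rV[R]_n -> 'rV[R]_n := div2 G (deform G u).

End Coordinates.

Section Fields.
Context {R : realType} {n : nat} {M : topologicalType}.
Variable A : smooth_atlas R n M.

Definition is_riemannian_metric (g : A -> 'rV[R]_n -> 'M[R]_n) : Prop :=
  [/\ forall i, smooth_on (cod i) (g i),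
      forall i y, cod i y -> (g i y)^T = g i y,
      forall i y, cod i y ->
        forall w : 'rV[R]_n, w != 0 -> 0 < (w *m g i y *m w^T) 0 0
    & forall i j y, cod i y -> dom j (param i y) ->
        g i y = jacobian (transition i j) y *m g j (transition i j y)
                  *m (jacobian (transition i j) y)^T].

Definition vector_law (u : A -> 'rV[R]_n -> 'rV[R]_n) : Prop :=
  forall i j y, cod i y -> dom j (param i y) ->
    u j (transition i j y) = u i y *m jacobian (transition i j) y.

Definition is_vector_field (u : A -> 'rV[R]_n -> 'rV[R]_n) : Prop :=
  (forall i, smooth_on (cod i) (u i)) /\ vector_law u.

(* Fields depending on a time in T are smooth jointly in time and space. *)
Definition is_time_vector_field (T : set R)
    (u : R -> A -> 'rV[R]_n -> 'rV[R]_n) : Prop :=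
  (forall i, smooth_on (T `*` cod i) (fun z : R * 'rV[R]_n => u z.1 i z.2)) /\
  (forall t, T t -> vector_law (u t)).

Definition is_time_function (T : set R) (p : R -> M -> R) : Prop :=
  forall i : A,
    smooth_on (T `*` cod i) (fun z : R * 'rV[R]_n => p z.1 (param i z.2)).

Variable g : A -> 'rV[R]_n -> 'M[R]_n.

Definition is_killing (v : A -> 'rV[R]_n -> 'rV[R]_n) : Prop :=
  is_vector_field v /\ forall i y, cod i y -> deform (g i) (v i) y = 0.

(* [u,v] = nabla_u v - nabla_v u *)
Definition bracket (u v : A -> 'rV[R]_n -> 'rV[R]_n) (i : A) (y : 'rV[R]_n) :
  'rV[R]_n := nabla (g i) (u i) (v i) y - nabla (g i) (v i) (u i) y.

Definition grad_field (p : M -> R) (i : A) : 'rV[R]_n -> 'rV[R]_n :=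
  grad (g i) (p \o param i).

(* The function g(u,v) on M.  For vector fields u and v the value at x is the
   same in every chart around x, so that the choice of chart_at is immaterial. *)
Definition metric_pair (u v : A -> 'rV[R]_n -> 'rV[R]_n) (x : M) : R :=
  let i := chart_at A x in let y := chart i x in
  (u i y *m g i y *m (v i y)^T) 0 0.

Definition is_solution (T : set R) (mu : R)
    (v : A -> 'rV[R]_n -> 'rV[R]_n)
    (u : R -> A -> 'rV[R]_n -> 'rV[R]_n) (p : R -> M -> R) : Prop :=
  [/\ is_time_vector_field T u, is_time_function T p
    & forall t, T t -> forall i y, cod i y ->
      derive1 (fun s => u s i y) t
        + nabla (g i) (u t i) (v i) y + nabla (g i) (v i) (u t i) y
        - mu *: Lop (g i) (u t i) y + grad_field (p t) i y = 0
      /\ divergence (g i) (u t i) y = 0].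

End Fields.

(* Main.v *)
Require Import Defs.
From HB Require Import structures.
From mathcomp Require Import all_boot all_order all_algebra.
From mathcomp Require Import all_classical all_reals all_analysis.
From mathcomp Require Import ring.
Set Implicit Arguments.
Unset Strict Implicit.
Unset Printing Implicit Defensive.
Import Order.TTheory GRing.Theory Num.Theory.
Import numFieldNormedType.Exports.
Local Open Scope classical_set_scope.
Local Open Scope ring_scope.

(** The flow of a Killing field [v] consists of isometries, so the Lie
    derivative along [v] commutes with every operation built from the metric:
    the connection, the divergence, the deformation tensor, the gradient.  As
    [v] does not depend on time, it also commutes with the time derivative, and
    it annihilates [v] itself.  Hence it sends a solution [(u, p)] of the
    linearized system to a solution, and up to the sign the new solution is the
    pair of the theorem: [[u,v]] is minus the Lie derivative of [u], and
    [- g(grad p, v)] is minus the Lie derivative of [p].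

    In components, the commutation is a polynomial identity between derivatives
    of the metric, of [v] and of the solution at a point of a chart.  It rests on
    one property of partial derivatives, that they are commuting derivations of
    the ring of smooth functions, so it is proved over an abstract commutative
    ring with commuting derivations.  There a tensor is a matrix over the ring,
    and its Lie derivative is the derivative of its entries along [v] corrected
    by products with the Jacobian matrix [A] of [v].  Christoffel symbols are not a tensor; invariance of the Levi-Civita
    connection reads [levi_civita_lie], in which the second derivatives of [v]
    appear as the correction.  It follows from invariance of the metric, which
    is the Killing equation ([killing_lie_cov]).  Covariant derivative
    ([cov_mx_lie]), divergence of a twice contravariant tensor ([div2_mx_lie])
    and gradient ([grad_mx_lie]) then commute with the Lie derivative, and
    [momentum_mx_lie] collects this for the whole equation.

    The abstract ring is realized by the smooth functions on an open subset of
    space-time, with equality tested on that subset; its derivations commute by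
    the symmetry of second derivatives ([schwarz]), proved from the mean value
    theorem.  Evaluating the identities at a point gives the statement in a
    chart ([chart_killing_solution]).  What remains is global: the bracket of
    two vector fields obeys the transformation law ([bracket_vector_law], again
    by symmetry of the second derivatives of the transition map), and the
    pairing with the gradient is the derivative along [v] in whichever chart it
    is computed ([metric_pair_grad]). *)

(** * Linear identities between matrices *)
Lemma mx_entryD (K : pzRingType) m n (X Y : 'M[K]_(m, n)) i j :
  (X + Y) i j = X i j + Y i j.
Proof. by rewrite mxE. Qed.

Lemma mx_entryN (K : pzRingType) m n (X : 'M[K]_(m, n)) i j :
  (- X) i j = - X i j.
Proof. by rewrite mxE. Qed.

Lemma mx_entryZ (K : pzRingType) m n a (X : 'M[K]_(m, n)) i j :
  (a *: X) i j = a * X i j.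
Proof. by rewrite mxE. Qed.

(** Compares the two sides entry by entry, with products of matrices, derived
    matrices and sums as atoms of a commutative ring identity.  Rewriting with
    [mxE] would open these atoms. *)
Ltac mx_linear :=
  apply/matrixP => ? ?; rewrite ?(mx_entryD, mx_entryN, mx_entryZ); ring.

Ltac mx_abelian :=
  rewrite ?mulmxDl ?mulmxDr ?mulmxBl ?mulmxBr ?mulNmx ?mulmxN
    -?scalemxAl -?scalemxAr ?mulmxA; mx_linear.

(** * Derivations acting on matrices *)
Section MatrixDerivation.
Variables (K : comPzRingType) (D : {additive K -> K}).
Hypothesis DM : forall a b, D (a * b) = D a * b + a * D b.

Lemma derivation1 : D 1 = 0.
Proof.
have := DM 1 1; rewrite !mulr1 mul1r => /(congr1 (fun x => x - D 1)).
by rewrite addrK subrr.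
Qed.

Lemma derivation_mulmx m n p (X : 'M[K]_(m, n)) (Y : 'M[K]_(n, p)) :
  map_mx D (X *m Y) = map_mx D X *m Y + X *m map_mx D Y.
Proof.
apply/matrixP=> i j; rewrite !mxE raddf_sum -big_split.
by apply: eq_bigr => k _; rewrite !mxE DM.
Qed.

Lemma derivation_scalemx m n a (X : 'M[K]_(m, n)) :
  map_mx D (a *: X) = D a *: X + a *: map_mx D X.
Proof. by apply/matrixP=> i j; rewrite !mxE DM. Qed.

Lemma derivation_scalar_mx n : map_mx D (1%:M : 'M[K]_n) = 0.
Proof.
apply/matrixP=> i j; rewrite !mxE.
by case: eqP => _; rewrite ?mulr1n ?mulr0n ?raddf0 // derivation1.
Qed.

(** Twice [D h] is [D 1 = 0], and [h] times twice [D h] is [D h]. *)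
Lemma derivation_half h : h + h = 1 -> D h = 0.
Proof.
move=> hh; rewrite -[D h]mul1r -hh mulrDl -mulrDr -raddfD hh derivation1.
exact: mulr0.
Qed.

End MatrixDerivation.

(** * Lie derivatives over a ring with commuting derivations *)
Section LieDerivative.
Variables (K : comPzRingType) (n : nat) (d : 'I_n -> {additive K -> K}).
Hypothesis dM : forall k a b, d k (a * b) = d k a * b + a * d k b.
Hypothesis dC : forall k l a, d k (d l a) = d l (d k a).
Variable v : 'rV[K]_n.

(** The Lie derivative of a function. *)
Definition dirder (a : K) : K := \sum_l v 0 l * d l a.

Lemma dirder_is_additive : zmod_morphism dirder.
Proof.
move=> a b; rewrite /dirder -sumrB; apply: eq_bigr => l _.
by rewrite raddfB mulrBr.
Qed.

HB.instance Definition _ :=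
  GRing.isZmodMorphism.Build K K dirder dirder_is_additive.

Lemma dirderM a b : dirder (a * b) = dirder a * b + a * dirder b.
Proof.
rewrite /dirder mulr_suml mulr_sumr -big_split; apply: eq_bigr => l _ /=.
by rewrite dM; ring.
Qed.

Local Notation dl := (map_mx dirder).

(** The lower index of [u^k_{,i}] is the row, so that vector fields, which are
    rows, are differentiated along [w] by left multiplication with [w]. *)
Definition diff_mx (u : 'rV[K]_n) : 'M[K]_n := \matrix_(i, k) d i (u 0 k).

Local Notation A := (diff_mx v).

(** The coefficients of [dirder] are not constant: moving a partial derivative
    through it produces the matrix [A].  All correction terms of the Lie
    derivatives below compensate this. *)
Lemma dirder_comm i a : dirder (d i a) = d i (dirder a) - \sum_l A i l * d l a.
Proof.
rewrite /dirder raddf_sum -sumrB; apply: eq_bigr => l _.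
by rewrite mxE dM (dC l i); ring.
Qed.

Lemma diff_mx_dirder u : dl (diff_mx u) = diff_mx (dl u) - A *m diff_mx u.
Proof.
apply/matrixP=> i k; rewrite !mxE dirder_comm; congr (_ - _).
by apply: eq_bigr => l _; rewrite !mxE.
Qed.

Lemma dirder_map_mx l m p (X : 'M[K]_(m, p)) :
  dl (map_mx (d l) X) = map_mx (d l) (dl X) - \sum_q A l q *: map_mx (d q) X.
Proof.
apply/matrixP=> i k; rewrite !mxE summxE dirder_comm; congr (_ - _).
by apply: eq_bigr => q _; rewrite !mxE.
Qed.

(** Both sides are the second derivative of the component [k] of [v]. *)
Lemma diff_mx_sym i l k : d i (A l k) = d l (A i k).
Proof. by rewrite !mxE dC. Qed.

Lemma diff_mxD u w : diff_mx (u + w) = diff_mx u + diff_mx w.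
Proof. by apply/matrixP=> i k; rewrite !mxE raddfD. Qed.

Lemma diff_mxN u : diff_mx (- u) = - diff_mx u.
Proof. by apply/matrixP=> i k; rewrite !mxE raddfN. Qed.

Lemma diff_mx_mul u X :
  diff_mx (u *m X) = diff_mx u *m X + \matrix_(i, k) \sum_l u 0 l * d i (X l k).
Proof.
apply/matrixP=> i k; rewrite !mxE raddf_sum -big_split.
by apply: eq_bigr => l _; rewrite !mxE dM.
Qed.

(** Lie derivatives of tensors, by type: an upper index contracts with [- A], a
    lower one with [A].  [lie_mix] is for matrices with a lower row index and an
    upper column index, [lie_con] for two upper indices, [lie_cov] for two lower
    indices. *)
Definition lie_vec (u : 'rV[K]_n) : 'rV[K]_n := dl u - u *m A.
Definition lie_mix (X : 'M[K]_n) : 'M[K]_n := dl X + A *m X - X *m A.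
Definition lie_con (X : 'M[K]_n) : 'M[K]_n := dl X - A^T *m X - X *m A.
Definition lie_cov (X : 'M[K]_n) : 'M[K]_n := dl X + A *m X + X *m A^T.

Lemma dirder_mulmx m q p (X : 'M[K]_(m, q)) (Y : 'M[K]_(q, p)) :
  dl (X *m Y) = dl X *m Y + X *m dl Y.
Proof. exact: (derivation_mulmx dirderM). Qed.

Lemma dirder_scalemx m q a (X : 'M[K]_(m, q)) :
  dl (a *: X) = dirder a *: X + a *: dl X.
Proof. exact: (derivation_scalemx dirderM). Qed.

Lemma lie_vec_self : lie_vec v = 0.
Proof.
apply/matrixP=> i k; rewrite /lie_vec !mxE ord1 /dirder.
by apply/eqP; rewrite subr_eq0; apply/eqP; apply: eq_bigr => l _; rewrite !mxE.
Qed.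

Lemma lie_vecD u w : lie_vec (u + w) = lie_vec u + lie_vec w.
Proof. by rewrite /lie_vec map_mxD mulmxDl opprD addrACA. Qed.

Lemma lie_vecN u : lie_vec (- u) = - lie_vec u.
Proof. by rewrite /lie_vec map_mxN mulNmx opprD. Qed.

Lemma lie_vec0 : lie_vec 0 = 0.
Proof. by rewrite /lie_vec map_mx0 mul0mx subr0. Qed.

Lemma lie_vec_sum (I : finType) (F : I -> 'rV[K]_n) :
  lie_vec (\sum_i F i) = \sum_i lie_vec (F i).
Proof. exact: (big_morph lie_vec lie_vecD lie_vec0). Qed.

Lemma lie_vecZ a u : lie_vec (a *: u) = dirder a *: u + a *: lie_vec u.
Proof. by rewrite /lie_vec dirder_scalemx scalerBr -scalemxAl addrA. Qed.

Lemma lie_vec_mul w X : lie_vec (w *m X) = lie_vec w *m X + w *m lie_mix X.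
Proof. rewrite /lie_vec /lie_mix dirder_mulmx; mx_abelian. Qed.

Lemma lie_mixD X Y : lie_mix (X + Y) = lie_mix X + lie_mix Y.
Proof. by rewrite /lie_mix map_mxD; mx_abelian. Qed.

Lemma lie_mixZ a X : lie_mix (a *: X) = dirder a *: X + a *: lie_mix X.
Proof. rewrite /lie_mix dirder_scalemx; mx_abelian. Qed.

Lemma lie_mix0 : lie_mix 0 = 0.
Proof. by rewrite /lie_mix map_mx0 mulmx0 mul0mx subr0 addr0. Qed.

Lemma lie_mix_sum (I : finType) (F : I -> 'M[K]_n) :
  lie_mix (\sum_i F i) = \sum_i lie_mix (F i).
Proof. exact: (big_morph lie_mix lie_mixD lie_mix0). Qed.

Lemma lie_mix_mul X Y : lie_mix (X *m Y) = lie_cov X *m Y + X *m lie_con Y.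
Proof. rewrite /lie_mix /lie_cov /lie_con dirder_mulmx; mx_abelian. Qed.

Lemma lie_con_mul X Y : lie_con (X *m Y) = lie_con X *m Y + X *m lie_mix Y.
Proof. rewrite /lie_mix /lie_con dirder_mulmx; mx_abelian. Qed.

Lemma mxtrace_dirder (X : 'M[K]_n) : \tr (dl X) = dirder (\tr X).
Proof. by rewrite /mxtrace raddf_sum; apply: eq_bigr => i _; rewrite mxE. Qed.

(** A contraction of an upper with a lower index: the two corrections cancel
    under the trace. *)
Lemma mxtrace_lie_mix X : \tr (lie_mix X) = dirder (\tr X).
Proof.
rewrite /lie_mix mxtraceD raddfN mxtraceD /= [\tr (X *m _)]mxtrace_mulC addrK.
exact: mxtrace_dirder.
Qed.

(** * Operations of a connection that is invariant under the flow *)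
Section InvariantConnection.
(** [Gam l i k] stands for [Gamma^k_{il}].  The hypothesis says that the Lie
    derivative of the connection is zero: the sum is the correction for the
    index [l], on which [lie_mix] does not act, and [map_mx (d l) A] holds the
    second derivatives of [v], by which Christoffel symbols fail to be a
    tensor. *)
Variable Gam : 'I_n -> 'M[K]_n.
Hypothesis lie_Gam : forall l, lie_mix (Gam l)
  = - (\sum_m A l m *: Gam m) - map_mx (d l) A.

Definition cov_mx (u : 'rV[K]_n) : 'M[K]_n :=
  diff_mx u + \sum_l u 0 l *: Gam l.

Lemma cov_mx0 : cov_mx 0 = 0.
Proof.
apply/matrixP=> i k; rewrite !mxE raddf0 summxE big1 ?addr0 // => l _.
by rewrite !mxE mul0r.
Qed.

Lemma cov_mxN u : cov_mx (- u) = - cov_mx u.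
Proof.
rewrite /cov_mx diff_mxN opprD -sumrN; congr (_ + _); apply: eq_bigr => l _.
by rewrite mxE scaleNr.
Qed.

(** Second derivatives of [v] appear because ordinary derivatives of components
    are not covariant; [cov_mx_lie] cancels them against those of [Gam]. *)
Lemma lie_mix_diff_mx u :
  lie_mix (diff_mx u) = diff_mx (lie_vec u) + \sum_l u 0 l *: map_mx (d l) A.
Proof.
rewrite /lie_mix /lie_vec diff_mx_dirder diff_mxD diff_mxN diff_mx_mul.
have -> : \matrix_(i, k) (\sum_l u 0 l * d i (A l k))
    = \sum_l u 0 l *: map_mx (d l) A.
  apply/matrixP=> i k; rewrite summxE mxE; apply: eq_bigr => l _.
  by rewrite diff_mx_sym !mxE.
mx_abelian.
Qed.

Lemma cov_mx_lie u : lie_mix (cov_mx u) = cov_mx (lie_vec u).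
Proof.
rewrite /cov_mx lie_mixD lie_mix_diff_mx lie_mix_sum -addrA; congr (_ + _).
rewrite -big_split /=.
under eq_bigr do rewrite lie_mixZ lie_Gam.
under [RHS]eq_bigr do rewrite /lie_vec !mxE scalerBl [X in _ - X]scaler_suml.
rewrite sumrB exchange_big /= -sumrB; apply: eq_bigr => l _.
under [X in _ = _ - X]eq_bigr do rewrite -scalerA.
rewrite -scaler_sumr; mx_abelian.
Qed.

Lemma nabla_lie w u :
  lie_vec (w *m cov_mx u) = lie_vec w *m cov_mx u + w *m cov_mx (lie_vec u).
Proof. by rewrite lie_vec_mul cov_mx_lie. Qed.

Definition divergence_mx (u : 'rV[K]_n) : K := \tr (cov_mx u).

Lemma divergence_mx_lie u : divergence_mx (lie_vec u) = dirder (divergence_mx u).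
Proof. by rewrite /divergence_mx -cov_mx_lie mxtrace_lie_mix. Qed.

(** The divergence [B^{kj}_{;k}], organized by the index [l] of the Christoffel
    symbols so that each summand is built from row vectors. *)
Definition div2_mx (B : 'M[K]_n) : 'rV[K]_n :=
  \sum_l (map_mx (d l) (row l B) + \tr (Gam l) *: row l B
           + row l B^T *m Gam l).

Lemma div2_mxN B : div2_mx (- B) = - div2_mx B.
Proof.
rewrite /div2_mx -sumrN; apply: eq_bigr => l _.
have rowN X : row l (- X) = - row l X by rewrite raddfN.
by rewrite [(- B)^T]raddfN /= !rowN map_mxN scalerN mulNmx !opprD.
Qed.

Lemma lie_conD X Y : lie_con (X + Y) = lie_con X + lie_con Y.
Proof. by rewrite /lie_con map_mxD; mx_abelian. Qed.

(** A row of a contravariant tensor is a vector whose row index still has to be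
    corrected. *)
Lemma row_lie_con l B :
  row l (lie_con B) = lie_vec (row l B) - \sum_m A m l *: row m B.
Proof.
rewrite /lie_con /lie_vec.
have -> : \sum_m A m l *: row m B = row l (A^T *m B).
  apply/matrixP=> i j; rewrite summxE !mxE; apply: eq_bigr => m _.
  by rewrite !mxE.
by rewrite !raddfB /= [row l (B *m A)]row_mul map_row addrAC.
Qed.

Lemma tr_lie_con B : (lie_con B)^T = lie_con B^T.
Proof.
rewrite /lie_con !(linearB, linearN) /= !trmx_mul map_trmx trmxK.
exact: addrAC.
Qed.

Lemma lie_vec_map_row l (b : 'rV[K]_n) :
  lie_vec (map_mx (d l) b) = map_mx (d l) (lie_vec b)
    + b *m map_mx (d l) A - \sum_m A l m *: map_mx (d m) b.
Proof.
rewrite /lie_vec dirder_map_mx raddfB /= (derivation_mulmx (dM l)).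
mx_abelian.
Qed.

(** Both sides are expanded into sums over [l].  The corrections for the index
    [l] match after an exchange of summations.  The second derivatives of [v]
    remain: those from [B^{kj}_{,k}] against the trace of [lie_Gam] for one
    index, against [lie_Gam] itself for the other. *)
Lemma div2_mx_lie B : div2_mx (lie_con B) = lie_vec (div2_mx B).
Proof.
pose V l := map_mx (d l) A.
have trV m l : d l (A m l) = d m (A l l) by rewrite diff_mx_sym.
have lie_tr l : dirder (\tr (Gam l))
    = - (\sum_m A l m * \tr (Gam m)) - \tr (V l).
  rewrite -mxtrace_lie_mix lie_Gam raddfB raddfN /=; congr (- _ - _).
  rewrite (raddf_sum (@mxtrace K n)); apply: eq_bigr => m _.
  by rewrite /= mxtraceZ.
pose b l := row l B; pose b' l := row l B^T.
rewrite /div2_mx lie_vec_sum.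
transitivity (\sum_l ((map_mx (d l) (lie_vec (b l))
      - \sum_m (d l (A m l) *: b m + A m l *: map_mx (d l) (b m)))
   + \tr (Gam l) *: (lie_vec (b l) - \sum_m A m l *: b m)
   + (lie_vec (b' l) - \sum_m A m l *: b' m) *m Gam l)).
  apply: eq_bigr => l _; rewrite tr_lie_con !row_lie_con raddfB raddf_sum /=.
  do 3!congr (_ + _); congr (- _); apply: eq_bigr => m _.
  by rewrite (derivation_scalemx (dM l)).
transitivity (\sum_l ((map_mx (d l) (lie_vec (b l)) + b l *m V l
      - \sum_m A l m *: map_mx (d m) (b l))
   + ((- (\sum_m A l m * \tr (Gam m)) - \tr (V l)) *: b l
      + \tr (Gam l) *: lie_vec (b l))
   + (lie_vec (b' l) *m Gam l + b' l *m (- (\sum_m A l m *: Gam m) - V l)))).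
  (* The derivative of the divergence of v, by symmetry of second derivatives. *)
  have traceE : \sum_l \sum_m d l (A m l) *: b m = \sum_l \tr (V l) *: b l.
    rewrite exchange_big; apply: eq_bigr => m _ /=; rewrite -scaler_suml.
    by congr (_ *: _); apply: eq_bigr => l _; rewrite trV !mxE.
  (* The indices of B are contracted with a symmetric array. *)
  have symE : \sum_l b l *m V l = \sum_l b' l *m V l.
    apply/matrixP=> i j; rewrite !summxE.
    under eq_bigr do rewrite mxE.
    under [RHS]eq_bigr do rewrite mxE.
    rewrite exchange_big; apply: eq_bigr => k _; apply: eq_bigr => l _.
    by rewrite [V l k j]mxE [V k l j]mxE diff_mx_sym !mxE.
  have e1 : \sum_l \sum_m A m l *: map_mx (d l) (b m)
          = \sum_l \sum_m A l m *: map_mx (d m) (b l) by exact: exchange_big.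
  have e2 : \sum_l \sum_m (\tr (Gam l) * A m l) *: b m
          = \sum_l \sum_m (A l m * \tr (Gam m)) *: b l.
    rewrite exchange_big; apply: eq_bigr => l _; apply: eq_bigr => m _.
    by rewrite mulrC.
  have e3 : \sum_l \sum_m A m l *: (b' m *m Gam l)
          = \sum_l \sum_m A l m *: (b' l *m Gam m) by exact: exchange_big.
  transitivity (\sum_l (map_mx (d l) (lie_vec (b l))
      + \tr (Gam l) *: lie_vec (b l) + lie_vec (b' l) *m Gam l)
    - \sum_l \tr (V l) *: b l - \sum_l \sum_m A l m *: map_mx (d m) (b l)
    - \sum_l \sum_m (A l m * \tr (Gam m)) *: b l
    - \sum_l \sum_m A l m *: (b' l *m Gam m)
    + \sum_l b l *m V l - \sum_l b' l *m V l).
    rewrite symE addrK -traceE -e1 -e2 -e3 -!sumrB; apply: eq_bigr => l _.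
    rewrite big_split /= scalerBr scaler_sumr mulmxBl mulmx_suml.
    under [X in _ + (_ - X) + _ = _]eq_bigr do rewrite scalerA.
    under [X in _ + (_ - X) = _]eq_bigr do rewrite -scalemxAl.
    mx_abelian.
  rewrite -!sumrB -big_split -sumrB; apply: eq_bigr => l _ /=.
  rewrite scalerBl scaleNr [X in _ = _ + (- X - _ + _) + _]scaler_suml.
  rewrite mulmxBr mulmxN mulmx_sumr.
  under [X in _ = _ + (_ + (- X - _))]eq_bigr do rewrite -scalemxAr.
  mx_abelian.
apply: eq_bigr => l _; rewrite !lie_vecD lie_vec_map_row lie_vecZ lie_vec_mul.
by rewrite lie_Gam lie_tr.
Qed.

End InvariantConnection.

(** * The Levi-Civita connection of an invariant metric *)
Section LeviCivita.
(** [G] is the metric, [H] its inverse and [h] one half. *)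
Variables (h : K) (G H : 'M[K]_n).
Hypothesis h2 : h + h = 1.
Hypothesis Gsym : G^T = G.
Hypothesis GH : G *m H = 1%:M.

(** Twice the Christoffel symbols of the first kind: row [i] and column [m] hold
    [g_{im,l} + g_{lm,i} - g_{li,m}]. *)
Definition first_kind (l : 'I_n) : 'M[K]_n :=
  map_mx (d l) G + diff_mx (row l G) - (diff_mx (row l G))^T.

Definition levi_civita (l : 'I_n) : 'M[K]_n := h *: (first_kind l *m H).

Lemma metric_inverse_sym : H^T = H.
Proof.
have HTG : H^T *m G = 1%:M by rewrite -[G]Gsym -trmx_mul GH trmx1.
by rewrite -[LHS]mulmx1 -GH mulmxA HTG mul1mx.
Qed.

Lemma metric_inverse_mulmx : H *m G = 1%:M.
Proof. by rewrite -[H]metric_inverse_sym -[G]Gsym -trmx_mul GH trmx1. Qed.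

(** The antisymmetric part of [first_kind] drops out of the symmetrized
    covariant derivative of [v], and the symmetric part is the derivative of the
    metric along [v]. *)
Lemma killing_lie_cov :
  H *m cov_mx levi_civita v + (cov_mx levi_civita v)^T *m H = 0 ->
  lie_cov G = 0.
Proof.
set N := cov_mx _ v => kill.
have NG : N *m G = A *m G + h *: \sum_l v 0 l *: first_kind l.
  rewrite /N /cov_mx mulmxDl; congr (_ + _).
  rewrite mulmx_suml scaler_sumr; apply: eq_bigr => l _.
  rewrite -scalemxAl -scalemxAl -mulmxA metric_inverse_mulmx mulmx1.
  by rewrite scalerA mulrC scalerA.
have first_kindT l : first_kind l + (first_kind l)^T
    = map_mx (d l) G + map_mx (d l) G.
  rewrite /first_kind !linearD /= !linearN /= trmxK map_trmx Gsym; mx_abelian.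
have sumT : \sum_l v 0 l *: first_kind l + (\sum_l v 0 l *: first_kind l)^T
    = map_mx dirder G + map_mx dirder G.
  have -> : map_mx dirder G = \sum_l v 0 l *: map_mx (d l) G.
    apply/matrixP=> i j; rewrite summxE mxE; apply: eq_bigr => l _.
    by rewrite !mxE.
  rewrite raddf_sum -!big_split; apply: eq_bigr => l _ /=.
  by rewrite linearZ /= -!scalerDr first_kindT.
have NGT : N *m G + (N *m G)^T = 0.
  have := congr1 (fun X => G *m X *m G) kill.
  rewrite mulmxDr mulmxDl !mulmxA GH mul1mx -2!mulmxA metric_inverse_mulmx.
  rewrite mulmx1 mulmx0 mul0mx.
  by rewrite trmx_mul Gsym.
rewrite -NGT NG linearD linearZ /= addrACA -scalerDr sumT scalerDr -scalerDl h2.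
rewrite scale1r trmx_mul Gsym /lie_cov; mx_abelian.
Qed.

Hypothesis lieG : lie_cov G = 0.

Lemma dirder_metric : map_mx dirder G = - (A *m G) - G *m A^T.
Proof.
move/eqP: lieG; rewrite /lie_cov -addrA addr_eq0 => /eqP->.
by rewrite opprD.
Qed.

(** Differentiate [H *m G = 1] along [v]. *)
Lemma lie_con_metric_inverse : lie_con H = 0.
Proof.
have := derivation_scalar_mx dirderM n.
rewrite -metric_inverse_mulmx dirder_mulmx dirder_metric => /(congr1 (mulmx^~ H)).
rewrite mulmxDl mul0mx mulmxBr mulmxN !mulmxBl mulNmx -!mulmxA GH !mulmx1.
rewrite !mulmxA metric_inverse_mulmx mul1mx.
rewrite /lie_con => <-; mx_abelian.
Qed.

(** The three terms of [first_kind] are Lie derived separately.  Derivatives of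
    the metric give second derivatives of [v] contracted with [G]: the array [Q],
    symmetric in its two free indices, cancels between the last two terms of
    [first_kind]; minus twice [map_mx (d l) A *m G] survives. *)
Lemma lie_cov_first_kind l :
  lie_cov (first_kind l)
  = - (\sum_m A l m *: first_kind m)
    - (map_mx (d l) A *m G + map_mx (d l) A *m G).
Proof.
pose V := map_mx (d l) A.
pose Q : 'M[K]_n := \matrix_(i, k) \sum_m G l m * d i (A k m).
have QT : Q^T = Q.
  apply/matrixP=> i k; rewrite !mxE; apply: eq_bigr => m _.
  by rewrite diff_mx_sym.
have lie_dG : lie_cov (map_mx (d l) G) = - (\sum_m A l m *: map_mx (d m) G)
    - V *m G - G *m V^T.
  rewrite /lie_cov dirder_map_mx dirder_metric raddfB raddfN /=.
  rewrite !(derivation_mulmx (dM l)) map_trmx; mx_abelian.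
have lie_E : lie_cov (diff_mx (row l G))
    = - (\sum_m A l m *: diff_mx (row m G)) - V *m G - Q.
  have dlrow : map_mx dirder (row l G)
      = - (row l A *m G) - row l G *m A^T.
    by rewrite map_row dirder_metric raddfB raddfN /= !row_mul.
  have VE : diff_mx (row l A) = V.
    by apply/matrixP=> i m; rewrite [LHS]mxE [row l A 0 m]mxE diff_mx_sym !mxE.
  have sumE : \matrix_(i, k) (\sum_m row l A 0 m * d i (G m k))
      = \sum_m A l m *: diff_mx (row m G).
    apply/matrixP=> i k; rewrite summxE mxE; apply: eq_bigr => m _.
    by rewrite !mxE.
  have QE : \matrix_(i, k) (\sum_m row l G 0 m * d i (A^T m k)) = Q.
    apply/matrixP=> i k; rewrite !mxE; apply: eq_bigr => m _.
    by rewrite [row l G 0 m]mxE [A^T m k]mxE.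
  rewrite /lie_cov diff_mx_dirder dlrow diff_mxD !diff_mxN !diff_mx_mul VE sumE QE.
  mx_abelian.
have lie_covT X : lie_cov X^T = (lie_cov X)^T.
  rewrite /lie_cov !linearD /= !trmx_mul trmxK map_trmx; mx_abelian.
have -> : lie_cov (first_kind l) = lie_cov (map_mx (d l) G)
    + lie_cov (diff_mx (row l G)) - (lie_cov (diff_mx (row l G)))^T.
  rewrite -lie_covT /first_kind /lie_cov raddfB raddfD /=; mx_abelian.
have -> : \sum_m A l m *: first_kind m = \sum_m A l m *: map_mx (d m) G
    + \sum_m A l m *: diff_mx (row m G) - (\sum_m A l m *: diff_mx (row m G))^T.
  rewrite (raddf_sum (@trmx K n n)) -big_split -sumrB; apply: eq_bigr => m _ /=.
  rewrite [(A l m *: _)^T]linearZ; mx_abelian.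
have VGT : (V *m G)^T = G *m V^T by rewrite trmx_mul Gsym.
have -> : (lie_cov (diff_mx (row l G)))^T
    = - (\sum_m A l m *: diff_mx (row m G))^T - G *m V^T - Q.
  rewrite lie_E -VGT -{2}QT; apply/matrixP=> i k.
  by rewrite !(mx_entryD, mx_entryN, mxE).
rewrite lie_dG lie_E -/V; mx_abelian.
Qed.

(** An invariant metric has an invariant connection: raising an index with the
    invariant [H] turns the previous lemma into the hypothesis on [Gam]. *)
Lemma levi_civita_lie l : lie_mix (levi_civita l)
  = - (\sum_m A l m *: levi_civita m) - map_mx (d l) A.
Proof.
have dh : dirder h = 0 by apply: (derivation_half dirderM).
rewrite lie_mixZ dh scale0r add0r.
rewrite lie_mix_mul lie_con_metric_inverse mulmx0 addr0 lie_cov_first_kind.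
rewrite mulmxBl mulNmx mulmxDl -mulmxA GH mulmx1 scalerBr scalerDr -scalerDl h2.
rewrite scale1r scalerN mulmx_suml scaler_sumr; congr (- _ - _).
by apply: eq_bigr => m _; rewrite -scalemxAl !scalerA mulrC.
Qed.

Local Notation cov := (cov_mx levi_civita).
Local Notation div2 := (div2_mx levi_civita).

Lemma levi_civita_sym l i k : levi_civita l i k = levi_civita i l k.
Proof.
rewrite !mxE; congr (_ * _); apply: eq_bigr => m _; congr (_ * _).
have Gs a b : G a b = G b a by rewrite -[in LHS]Gsym mxE.
by rewrite !mxE (Gs i l); ring.
Qed.

(** The connection is torsion free. *)
Lemma bracket_lie_vec u : u *m cov v - v *m cov u = - lie_vec u.
Proof.
have Gam_sym : \sum_l v 0 l *: (u *m levi_civita l)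
    = \sum_l u 0 l *: (v *m levi_civita l).
  apply/matrixP=> i k; rewrite !summxE.
  under eq_bigr do rewrite !mxE mulr_sumr.
  under [RHS]eq_bigr do rewrite !mxE mulr_sumr.
  rewrite exchange_big; apply: eq_bigr => l _; apply: eq_bigr => m _.
  by rewrite ord1 levi_civita_sym; ring.
have dirE : v *m diff_mx u = map_mx dirder u.
  apply/matrixP=> i k; rewrite !mxE ord1; apply: eq_bigr => l _.
  by rewrite mxE.
rewrite /cov_mx !mulmxDr !mulmx_sumr dirE /lie_vec.
under eq_bigr do rewrite -scalemxAr.
under [X in _ - (_ + X) = _]eq_bigr do rewrite -scalemxAr.
rewrite Gam_sym; mx_abelian.
Qed.

Definition deform_mx (u : 'rV[K]_n) : 'M[K]_n := H *m cov u + (cov u)^T *m H.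

Lemma deform_mx_lie u : deform_mx (lie_vec u) = lie_con (deform_mx u).
Proof.
have lc := levi_civita_lie.
have deformE w : deform_mx w = H *m cov w + (H *m cov w)^T.
  by rewrite trmx_mul metric_inverse_sym.
rewrite !deformE lie_conD -tr_lie_con lie_con_mul lie_con_metric_inverse.
by rewrite mul0mx add0r cov_mx_lie.
Qed.

Definition grad_mx (a : K) : 'rV[K]_n := (\row_j d j a) *m H^T.

Lemma grad_mx_lie a : grad_mx (dirder a) = lie_vec (grad_mx a).
Proof.
have dlrow : map_mx dirder (\row_j d j a)
    = \row_j d j (dirder a) - (\row_j d j a) *m A^T.
  apply/matrixP=> i k; rewrite !mxE dirder_comm; congr (_ - _).
  by apply: eq_bigr => l _; rewrite !mxE mulrC.
rewrite /grad_mx metric_inverse_sym.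
have lH : map_mx dirder H = A^T *m H + H *m A.
  move/eqP: lie_con_metric_inverse.
  by rewrite /lie_con -addrA -opprD subr_eq0 => /eqP.
rewrite /lie_vec dirder_mulmx dlrow lH; mx_abelian.
Qed.

(** [dt] is the time derivative, and the field [v] is stationary. *)
Variables (dt : {additive K -> K}) (mu : K).
Hypothesis dtM : forall a b, dt (a * b) = dt a * b + a * dt b.
Hypothesis dtC : forall k a, dt (d k a) = d k (dt a).
Hypothesis dtv : map_mx dt v = 0.
Hypothesis dmu : forall k, d k mu = 0.

(** The left-hand side of the linearized momentum equation. *)
Definition momentum_mx (u : 'rV[K]_n) (a : K) : 'rV[K]_n :=
  map_mx dt u + u *m cov v + v *m cov u - mu *: div2 (deform_mx u) + grad_mx a.

Lemma dt_lie u : map_mx dt (lie_vec u) = lie_vec (map_mx dt u).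
Proof.
have vt k : dt (v 0 k) = 0.
  by have := congr1 (fun w : 'rV[K]_n => w 0 k) dtv; rewrite !mxE.
have At : map_mx dt A = 0.
  by apply/matrixP=> i k; rewrite !mxE dtC vt raddf0.
rewrite /lie_vec raddfB /= (derivation_mulmx dtM) At mulmx0 addr0.
congr (_ - _); apply/matrixP=> i k; rewrite !mxE /dirder raddf_sum.
by apply: eq_bigr => l _; rewrite dtM vt mul0r add0r dtC.
Qed.

(** All the terms commute with the Lie derivative; it obeys the product rule, and
    the terms in which it falls on [v] vanish by [lie_vec_self]. *)
Lemma momentum_mx_lie u a :
  momentum_mx (lie_vec u) (dirder a) = lie_vec (momentum_mx u a).
Proof.
have lc := levi_civita_lie.
have mu0 : dirder mu = 0.
  by rewrite /dirder big1 // => k _; rewrite dmu mulr0.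
rewrite /momentum_mx !lie_vecD lie_vecN lie_vecZ mu0 scale0r add0r.
rewrite dt_lie grad_mx_lie deform_mx_lie div2_mx_lie // !nabla_lie // lie_vec_self.
by rewrite cov_mx0 mulmx0 mul0mx !addr0 add0r.
Qed.

Lemma momentum_mxN u a : momentum_mx (- u) (- a) = - momentum_mx u a.
Proof.
have gradN : grad_mx (- a) = - grad_mx a.
  rewrite /grad_mx -mulNmx; congr (_ *m _).
  by apply/matrixP=> i j; rewrite !mxE raddfN.
have defN : deform_mx (- u) = - deform_mx u.
  by rewrite /deform_mx cov_mxN [(- _)^T]raddfN /= mulmxN mulNmx opprD.
rewrite /momentum_mx gradN defN div2_mxN cov_mxN map_mxN mulNmx.
rewrite [v *m (- _)]mulmxN; mx_linear.
Qed.

End LeviCivita.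
End LieDerivative.

(** * Functions of class C^k *)
Section SmoothOn.
Variable R : realType.
Implicit Types V W : normedModType R.

(** The differential at [x] is characterized by a Landau expansion, which only
    depends on the germ of the function. *)
Lemma near_eq_differentiable V W (f g : V -> W) x :
  (\near x, f x = g x) -> differentiable f x -> differentiable g x.
Proof.
move=> fg df; have fgx : f x = g x by exact: nbhs_singleton fg.
have gE : g \o shift x = cst (g x) + 'd f x +o_ 0 id.
  apply/eqaddoP => _/posnumP[e].
  have /eqaddoP/(_ _ [gt0 of e%:num]) := diff_locally df.
  have : \forall y \near (0 : V), f (y + x) = g (y + x).
    by move: fg; rewrite (near_shift 0) /= subr0; apply: filterS => y /=.
  apply: filterS2 => y /= fgy; rewrite -fgx.
  by rewrite /= !fctE /= fgy.
apply/diff_locallyP; rewrite (diff_unique (diff_continuous df) gE).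
by split => //; exact: diff_continuous.
Qed.

(** The rules for derivatives hold only where the functions are differentiable;
    locality lets them be used under the iterated derivatives of [Ck_on]. *)
Lemma Ck_on_ext V W (U : set V) k (f g : V -> W) : open U ->
  (forall x, U x -> f x = g x) -> Ck_on U k f -> Ck_on U k g.
Proof.
move=> oU; elim: k f g => [|k IH] f g fg /=.
  move=> fc x Ux; change (g @ x --> g x); rewrite -(fg x Ux).
  apply: cvg_trans (fc x Ux); apply: near_eq_cvg.
  by near=> y; apply: fg; near: y; exact: open_nbhs_nbhs.
have nfg x : U x -> \near x, f x = g x.
  by move=> Ux; near=> y; apply: fg; near: y; exact: open_nbhs_nbhs.
move=> [df fk]; split=> [x Ux|w].
  by apply: near_eq_differentiable (df x Ux); exact: nfg.
by apply: (IH ('D_w f)) (fk w) => x Ux; apply: near_eq_derive; exact: nfg.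
Unshelve. all: by end_near. Qed.

Lemma Ck_onW V W (U : set V) k (f : V -> W) : Ck_on U k.+1 f -> Ck_on U k f.
Proof.
elim: k f => [|k IH] f.
  by move=> [df _] x /df; exact: differentiable_continuous.
by move=> [df fk]; split=> // w; exact: IH.
Qed.

Lemma Ck_on_cst V W (U : set V) k (c : W) : Ck_on U k (cst c : V -> W).
Proof.
elim: k c => [|k IH] c /=; first by move=> x _; exact: cst_continuous.
split=> [x _|w]; first exact: differentiable_cst.
by rewrite (_ : 'D_w _ = cst 0) //; apply/funext => x; rewrite derive_cst.
Qed.

Lemma Ck_onD V W (U : set V) k (f g : V -> W) : open U ->
  Ck_on U k f -> Ck_on U k g -> Ck_on U k (f \+ g).
Proof.
move=> oU; elim: k f g => [|k IH] f g /=.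
  by move=> fc gc x Ux; apply: continuousD; [exact: fc|exact: gc].
move=> [df fk] [dg gk]; split=> [x Ux|w].
  by apply: differentiableD; [exact: df|exact: dg].
apply: Ck_on_ext (IH _ _ (fk w) (gk w)) => // x Ux /=.
by rewrite -deriveD //; apply: diff_derivable; [exact: df|exact: dg].
Qed.

Lemma Ck_onM V (U : set V) k (f g : V -> R) : open U ->
  Ck_on U k f -> Ck_on U k g -> Ck_on U k (f \* g).
Proof.
move=> oU; elim: k f g => [|k IH] f g.
  by move=> fc gc x Ux; apply: continuousM; [exact: fc|exact: gc].
move=> fk1 gk1; have fk := Ck_onW fk1; have gk := Ck_onW gk1.
case: fk1 gk1 => [df Df] [dg Dg]; split=> [x Ux|w].
  by apply: differentiableM; [exact: df|exact: dg].
apply: Ck_on_ext (Ck_onD oU (IH _ _ fk (Dg w)) (IH _ _ gk (Df w))) => // x Ux /=.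
by rewrite deriveM //; apply: diff_derivable; [exact: df|exact: dg].
Qed.

Lemma Ck_on_linear V W W' (U : set V) k (f : V -> W) (L : {linear W -> W'}) :
  open U -> continuous L -> Ck_on U k f -> Ck_on U k (L \o f).
Proof.
move=> oU cL; elim: k f => [|k IH] f /=.
  by move=> fc x Ux; apply: continuous_comp; [exact: fc|exact: cL].
have dL y : differentiable L y by exact: linear_differentiable.
move=> [df fk]; split=> [x Ux|w].
  by apply: differentiable_comp; [exact: df|exact: dL].
apply: Ck_on_ext (IH _ (fk w)) => // x Ux /=.
have dfx := df x Ux.
rewrite !deriveE //; last exact: differentiable_comp.
by rewrite (diff_comp dfx (dL (f x))) /= (diff_lin _ cL).
Qed.

Lemma derive_comp_linear V V' W (f : V -> W) (L : {linear V' -> V}) w :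
  'D_w (f \o L) = 'D_(L w) f \o L.
Proof.
apply/funext => a; rewrite /derive /=.
set q := (fun h : R => _); set q' := (fun h : R => _).
suff -> : q = q' by [].
by apply/funext => h; rewrite /q /q' [L (_ + _)]linearD [L (_ *: _)]linearZ.
Qed.

Lemma Ck_on_precomp V V' W (U : set V) (U' : set V') k (f : V -> W)
    (L : {linear V' -> V}) :
  (forall x, U' x -> U (L x)) -> continuous L ->
  Ck_on U k f -> Ck_on U' k (f \o L).
Proof.
move=> LU cL; elim: k f => [|k IH] f /=.
  by move=> fc x Ux; apply: continuous_comp; [exact: cL|exact/fc/LU].
have dL y : differentiable L y by exact: linear_differentiable.
move=> [df fk]; split=> [x Ux|w].
  by apply: differentiable_comp; [exact: dL|exact/df/LU].
by rewrite derive_comp_linear; exact: IH.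
Qed.

Lemma Ck_onN V (U : set V) k (f : V -> R) : open U ->
  Ck_on U k f -> Ck_on U k (\- f).
Proof.
move=> oU fk; have := Ck_onM oU (@Ck_on_cst V R U k (-1 : R)) fk.
by apply: Ck_on_ext => // x Ux /=; rewrite mulN1r.
Qed.

Lemma Ck_onV V (U : set V) k (f : V -> R) : open U ->
  (forall x, U x -> f x != 0) -> Ck_on U k f -> Ck_on U k (fun x => (f x)^-1).
Proof.
move=> oU f0; elim: k => [|k IH].
  by move=> fc x Ux; apply: continuousV; [exact: f0|exact: fc].
move=> fk1; have Ifk := IH (Ck_onW fk1).
case: fk1 => [df Df]; split=> [x Ux|w].
  by apply: differentiableV; [exact: df|exact: f0].
apply: Ck_on_ext (Ck_onN oU (Ck_onM oU (Ck_onM oU Ifk Ifk) (Df w))) => // x Ux /=.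
rewrite deriveV ?f0 //; last exact: diff_derivable (df x Ux).
by rewrite scaleNr /GRing.scale /= -exprVn expr2.
Qed.

End SmoothOn.

(** * Symmetry of second derivatives *)
Section Schwarz.
Variables (R : realType) (V : normedModType R).

Lemma is_derive_line (f : V -> R) c v (s df : R) :
  is_derive (s *: v + c) v f df ->
  is_derive s 1 (fun r : R => f (r *: v + c)) df.
Proof.
have qE : (fun h : R => h^-1 *: (((fun r : R => f (r *: v + c)) \o shift s) (h *: 1)
      - f (s *: v + c)))
    = (fun h : R => h^-1 *: ((f \o shift (s *: v + c)) (h *: v) - f (s *: v + c))).
  by apply/funext => h /=; rewrite [h *: 1]mulr1 scalerDl addrA.
by move=> [dv <-]; split; [rewrite /derivable qE|rewrite /derive qE].
Qed.

Lemma mean_value (F F' : R -> R) (h : R) : 0 < h ->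
  (forall s, 0 <= s <= h -> is_derive s 1 F (F' s)) ->
  exists2 s, 0 <= s <= h & F h - F 0 = F' s * h.
Proof.
move=> h0 dF.
have [||s hs Fs] := @MVT_segment R F F' 0 h (ltW h0).
- by move=> x /subset_itv_oo_cc; rewrite in_itv => /dF.
- by apply: derivable_within_continuous => x; rewrite in_itv => /dF[].
- by rewrite subr0 in Fs; exists s => //; rewrite in_itv in hs.
Qed.

(** The mean value theorem, applied first in the direction [v] to the difference
    of two translates of [f], then in the direction [w] to [fv]. *)
Lemma second_difference (U : set V) (f fv fvw : V -> R) a v w (h : R) :
  (forall y, U y -> is_derive y v f (fv y)) ->
  (forall y, U y -> is_derive y w fv (fvw y)) -> 0 < h ->
  (forall s t, 0 <= s <= h -> 0 <= t <= h -> U (s *: v + (t *: w + a))) ->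
  exists s t, [/\ 0 <= s <= h, 0 <= t <= h &
    f (h *: v + (h *: w + a)) - f (h *: v + a) - (f (h *: w + a) - f a)
    = fvw (s *: v + (t *: w + a)) * h * h].
Proof.
move=> dv dw h0 hU.
have hh : 0 <= h <= h by rewrite ltW //= lexx.
have h00 : (0 : R) <= 0 <= h by rewrite lexx ltW.
have [||s hs Fs] := @mean_value
  (fun s => f (s *: v + (h *: w + a)) - f (s *: v + (0 *: w + a)))
  (fun s => fv (s *: v + (h *: w + a)) - fv (s *: v + (0 *: w + a))) h.
- by [].
- by move=> s hs; apply: is_deriveB; apply: is_derive_line; apply: dv; exact: hU.
have [||t ht Gt] := @mean_value (fun t => fv (t *: w + (s *: v + a)))
  (fun t => fvw (t *: w + (s *: v + a))) h.
- by [].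
- by move=> t ht; apply: is_derive_line; apply: dw; rewrite addrCA; exact: hU.
exists s, t; split => //.
move: Fs; rewrite !scale0r !add0r => ->; congr (_ * _).
move: Gt; rewrite scale0r add0r (addrCA (t *: w)) => <-.
by rewrite (addrCA (h *: w)).
Qed.

(** The second difference is symmetric in [v] and [w], so its quotient by
    [h ^ 2] is a value of both mixed derivatives, taken at points whose distance
    from [a] is at most of order [h]. *)
Lemma mixed_derivatives_eq (U : set V) (f fv fw fvw fwv : V -> R) a v w :
  open U -> U a ->
  (forall y, U y -> is_derive y v f (fv y)) ->
  (forall y, U y -> is_derive y w fv (fvw y)) ->
  (forall y, U y -> is_derive y w f (fw y)) ->
  (forall y, U y -> is_derive y v fw (fwv y)) ->
  {for a, continuous fvw} -> {for a, continuous fwv} -> fvw a = fwv a.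
Proof.
move=> oU Ua dv dvw dw dwv cP cQ.
apply/eqP; rewrite -subr_eq0 -normr_eq0 -[_ == 0]negbK; apply/negP => PQ.
pose e := `|fvw a - fwv a| / 2.
have e0 : 0 < e by rewrite divr_gt0 // lt_def PQ normr_ge0.
have /cvgrPdist_lt/(_ e e0) nP : fvw @ a --> fvw a := cP.
have /cvgrPdist_lt/(_ e e0) nQ : fwv @ a --> fwv a := cQ.
have /nbhs_ballP[r /= r0 rU] : \forall y \near a,
    [/\ U y, `|fvw a - fvw y| < e & `|fwv a - fwv y| < e].
  have nU : \forall y \near a, U y by apply: open_nbhs_nbhs.
  by move: nU nP nQ; apply: filterS3 => y; split.
(* The summand 1 keeps m positive when v = w = 0. *)
pose m := `|v| + `|w| + 1.
have m0 : 0 < m by rewrite ltr_wpDl // addr_ge0.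
pose h := r / 2 / m.
have h0 : 0 < h by rewrite !divr_gt0.
have near_a s t : 0 <= s <= h -> 0 <= t <= h -> ball a r (s *: v + (t *: w + a)).
  move=> /andP[s0 sh] /andP[t0 th].
  rewrite -ball_normE /= addrA opprD addrCA subrr addr0 normrN.
  apply: (@le_lt_trans _ _ (h * m)).
    rewrite /m mulrDr mulr1 mulrDr ler_wpDr //; first exact: ltW.
    rewrite (le_trans (ler_normD _ _)) // !normrZ !ger0_norm //.
    by rewrite lerD // ler_wpM2r.
  by rewrite /h divfK ?gt_eqF // ltr_pdivrMr // ltr_pMr // ltr1n.
have [|s [t [hs ht E]]] := @second_difference U f fv fvw a v w h dv dvw h0.
  by move=> ? ? hs ht; have [] := rU _ (near_a _ _ hs ht).
have [|t' [s' [ht' hs' E']]] := @second_difference U f fw fwv a w v h dw dwv h0.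
  by move=> ? ? hx hy; rewrite addrCA; have [] := rU _ (near_a _ _ hy hx).
have PQE : fvw (s *: v + (t *: w + a)) = fwv (s' *: v + (t' *: w + a)).
  have hn0 : h != 0 by rewrite gt_eqF.
  rewrite (addrCA (s' *: v)); apply: (mulIf hn0); apply: (mulIf hn0).
  by rewrite -E -E' (addrCA (h *: w)); ring.
have [_ + _] := rU _ (near_a _ _ hs ht).
have [_ _] := rU _ (near_a _ _ hs' ht').
move=> lQ lP; rewrite PQE in lP.
have := ltrD lP lQ; rewrite /e -splitr.
rewrite [X in _ + X]distrC; apply/negP; rewrite -leNgt.
by rewrite (le_trans _ (ler_normD _ _)) // addrA subrK.
Qed.

Lemma schwarz (U : set V) (f : V -> R) a v w : open U -> U a ->
  Ck_on U 2 f -> 'D_w ('D_v f) a = 'D_v ('D_w f) a.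
Proof.
move=> oU Ua [df Df]; have [dv /(_ w) cvw] := Df v; have [dw /(_ v) cwv] := Df w.
apply: (@mixed_derivatives_eq U f ('D_v f) ('D_w f) _ _ a v w oU Ua _ _ _ _
  (cvw _ Ua) (cwv _ Ua)) => y Uy; apply/derivableP/diff_derivable.
- exact: df.
- exact: dv.
- exact: df.
- exact: dw.
Qed.

End Schwarz.

(** * The ring of smooth functions on an open set *)
Section SmoothFunctions.
Variables (R : realType) (V : normedModType R) (U : set V).

(** Functions are zero outside of [U], so that Leibniz equality is equality on
    [U]; the unit of the ring is the indicator function of [U].  The openness of
    [U] is a parameter of the type because the ring operations depend on it:
    only on an open set do derivatives on [U] ignore the cutoff. *)
Record smoothfun_on (oU : open U) := SmoothFun {
  smoothfun_val :> V -> R;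
  smoothfun_smooth : smooth_on U smoothfun_val;
  smoothfun_out : forall x, ~ U x -> smoothfun_val x = 0 }.

Variable oU : open U.
Local Notation smoothfun := (smoothfun_on oU).

Lemma smoothfun_ext (a b : smoothfun) : (forall x, U x -> a x = b x) -> a = b.
Proof.
case: a b => [a sa oa] [b sb ob] /= ab.
have {}ab : a = b.
  by apply/funext => x; have [/ab//|Ux] := pselect (U x); rewrite oa ?ob.
rewrite {a}ab in sa oa *.
by rewrite (Prop_irrelevance sa sb) (Prop_irrelevance oa ob).
Qed.

Definition cutoff (f : V -> R) (x : V) : R := if `[< U x >] then f x else 0.

Lemma cutoffE f x : U x -> cutoff f x = f x.
Proof. by rewrite /cutoff => /asboolP ->. Qed.

Lemma cutoff_smooth f : smooth_on U f -> smooth_on U (cutoff f).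
Proof. by move=> sf k; apply: Ck_on_ext (sf k) => // x /cutoffE. Qed.

Lemma cutoff_out f x : ~ U x -> cutoff f x = 0.
Proof. by rewrite /cutoff => /asboolPn/negbTE ->. Qed.

Definition mk_smoothfun f (sf : smooth_on U f) : smoothfun :=
  SmoothFun oU (cutoff_smooth sf) (@cutoff_out f).

Lemma mk_smoothfunE f (sf : smooth_on U f) x : U x -> mk_smoothfun sf x = f x.
Proof. exact: cutoffE. Qed.

HB.instance Definition _ := gen_eqMixin smoothfun.
HB.instance Definition _ := gen_choiceMixin smoothfun.

Lemma smooth_cst (c : R) : smooth_on U (cst c : V -> R).
Proof. by move=> k; exact: Ck_on_cst. Qed.

Lemma smoothD (a b : smoothfun) : smooth_on U (a \+ b).
Proof. by move=> k; apply: Ck_onD => //; exact: smoothfun_smooth. Qed.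

Lemma smoothM (a b : smoothfun) : smooth_on U (a \* b).
Proof. by move=> k; apply: Ck_onM => //; exact: smoothfun_smooth. Qed.

Lemma smoothN (a : smoothfun) : smooth_on U (\- a).
Proof. by move=> k; apply: Ck_onN => //; exact: smoothfun_smooth. Qed.

Lemma smooth_derive (w : V) (a : smoothfun) : smooth_on U ('D_w a).
Proof. by move=> k; have [_] := smoothfun_smooth a k.+1; exact. Qed.

Definition smoothfun_cst c := mk_smoothfun (smooth_cst c).
Definition smoothfun_add a b := mk_smoothfun (smoothD a b).
Definition smoothfun_mul a b := mk_smoothfun (smoothM a b).
Definition smoothfun_opp a := mk_smoothfun (smoothN a).
Definition smoothfun_derive w a := mk_smoothfun (smooth_derive w a).

Fact smoothfun_addA : associative smoothfun_add.
Proof.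
move=> a b c; apply: smoothfun_ext => x Ux.
by rewrite /= !cutoffE //= !cutoffE //= addrA.
Qed.
Fact smoothfun_addC : commutative smoothfun_add.
Proof.
by move=> a b; apply: smoothfun_ext => x Ux; rewrite /= !cutoffE //= addrC.
Qed.
Fact smoothfun_add0 : left_id (smoothfun_cst 0) smoothfun_add.
Proof.
move=> a; apply: smoothfun_ext => x Ux.
by rewrite /= !cutoffE //= cutoffE //= add0r.
Qed.
Fact smoothfun_addN : left_inverse (smoothfun_cst 0) smoothfun_opp smoothfun_add.
Proof.
move=> a; apply: smoothfun_ext => x Ux.
by rewrite /= !cutoffE //= cutoffE //= addNr.
Qed.

HB.instance Definition _ :=
  GRing.isZmodule.Build smoothfun smoothfun_addA smoothfun_addC smoothfun_add0
    smoothfun_addN.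

Fact smoothfun_mulA : associative smoothfun_mul.
Proof.
move=> a b c; apply: smoothfun_ext => x Ux.
by rewrite /= !cutoffE //= !cutoffE //= mulrA.
Qed.
Fact smoothfun_mulC : commutative smoothfun_mul.
Proof.
by move=> a b; apply: smoothfun_ext => x Ux; rewrite /= !cutoffE //= mulrC.
Qed.
Fact smoothfun_mul1 : left_id (smoothfun_cst 1) smoothfun_mul.
Proof.
move=> a; apply: smoothfun_ext => x Ux.
by rewrite /= !cutoffE //= cutoffE //= mul1r.
Qed.
Fact smoothfun_mulD : left_distributive smoothfun_mul +%R.
Proof.
move=> a b c; apply: smoothfun_ext => x Ux.
by rewrite /= !cutoffE //= !cutoffE //= mulrDl.
Qed.

HB.instance Definition _ := GRing.Zmodule_isComPzRing.Build smoothfun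
  smoothfun_mulA smoothfun_mulC smoothfun_mul1 smoothfun_mulD.

Lemma smoothfunDE (a b : smoothfun) x : U x -> (a + b) x = a x + b x.
Proof. exact: cutoffE. Qed.
Lemma smoothfunME (a b : smoothfun) x : U x -> (a * b) x = a x * b x.
Proof. exact: cutoffE. Qed.
Lemma smoothfunNE (a : smoothfun) x : U x -> (- a) x = - a x.
Proof. exact: cutoffE. Qed.
Lemma smoothfun0E x : U x -> (0 : smoothfun) x = 0.
Proof. exact: cutoffE. Qed.
Lemma smoothfun1E x : U x -> (1 : smoothfun) x = 1.
Proof. exact: cutoffE. Qed.
Lemma smoothfun_deriveE w (a : smoothfun) x : U x -> smoothfun_derive w a x = 'D_w a x.
Proof. exact: cutoffE. Qed.
Lemma smoothfun_sumE (I : finType) (F : I -> smoothfun) x : U x ->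
  (\sum_i F i) x = \sum_i F i x.
Proof.
move=> Ux; apply: (big_morph (fun a : smoothfun => a x)); last exact: smoothfun0E.
by move=> a b; exact: smoothfunDE.
Qed.

Lemma smoothfun_derivable (a : smoothfun) x w : U x -> derivable a x w.
Proof.
move=> Ux; apply: diff_derivable.
by have [da _] := smoothfun_smooth a 1; exact: da.
Qed.

Lemma smoothfun_near (a : smoothfun) (f : V -> R) x : U x ->
  (forall y, U y -> a y = f y) -> \near x, a x = f x.
Proof.
move=> Ux af; have : nbhs x U by exact: open_nbhs_nbhs.
by apply: filterS => y /af.
Qed.

Lemma smoothfun_deriveB w : zmod_morphism (smoothfun_derive w).
Proof.
move=> a b; apply: smoothfun_ext => x Ux.
rewrite smoothfunDE // smoothfunNE // !smoothfun_deriveE // -deriveB;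
  [|exact: smoothfun_derivable..].
apply: near_eq_derive; apply: smoothfun_near => // y Uy.
by rewrite smoothfunDE // smoothfunNE.
Qed.

HB.instance Definition _ w :=
  GRing.isZmodMorphism.Build smoothfun smoothfun (smoothfun_derive w)
    (smoothfun_deriveB w).

Lemma smoothfun_deriveM w (a b : smoothfun) :
  smoothfun_derive w (a * b) = smoothfun_derive w a * b + a * smoothfun_derive w b.
Proof.
apply: smoothfun_ext => x Ux.
rewrite smoothfunDE // !smoothfunME // !smoothfun_deriveE //.
transitivity ('D_w (a \* b) x).
  by apply: near_eq_derive; apply: smoothfun_near => // y Uy; rewrite smoothfunME.
rewrite deriveM; [|exact: smoothfun_derivable..].
by rewrite addrC mulrC.
Qed.

Lemma smoothfun_deriveC w1 w2 (a : smoothfun) :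
  smoothfun_derive w1 (smoothfun_derive w2 a)
  = smoothfun_derive w2 (smoothfun_derive w1 a).
Proof.
have E u1 u2 x : U x ->
    smoothfun_derive u1 (smoothfun_derive u2 a) x = 'D_u1 ('D_u2 a) x.
  move=> Ux; apply: etrans (smoothfun_deriveE _ _ Ux) _.
  by apply: near_eq_derive; apply: smoothfun_near => // y; exact: smoothfun_deriveE.
apply: smoothfun_ext => x Ux.
apply: etrans (E w1 w2 x Ux) (etrans _ (esym (E w2 w1 x Ux))).
exact: schwarz oU Ux (smoothfun_smooth a 2%N).
Qed.

End SmoothFunctions.

(* Otherwise simplification opens the ring operations down to the cutoff. *)
Arguments smoothfun_val : simpl never.

(** * Smooth maps with values in matrices *)
Section SmoothCoordinates.
Variables (R : realType) (V : normedModType R).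

(** Named in order to carry a structure of linear map. *)
Definition entry m p i j (X : 'M[R]_(m, p)) : R := X i j.

Fact entry_linear m p i j : linear (@entry m p i j).
Proof. by move=> a X Y; rewrite /entry !mxE. Qed.
HB.instance Definition _ m p i j := GRing.isLinear.Build R 'M[R]_(m, p) R _
  (@entry m p i j) (@entry_linear m p i j).

Lemma smooth_entry m p (U : set V) (f : V -> 'M[R]_(m, p)) i j : open U ->
  smooth_on U f -> smooth_on U (fun x => f x i j).
Proof.
move=> oU sf k.
by apply: (Ck_on_linear (L := @entry m p i j)) (sf k) => //; exact: coord_continuous.
Qed.

Definition scale_vec (W : normedModType R) (w : W) (r : R) : W := r *: w.

Fact scale_vec_linear W w : linear (@scale_vec W w).
Proof. by move=> a r s; rewrite /scale_vec scalerDl scalerA. Qed.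
HB.instance Definition _ (W : normedModType R) (w : W) :=
  GRing.isLinear.Build R R W _ (@scale_vec W w) (@scale_vec_linear W w).

Lemma smooth_scale (W : normedModType R) (U : set V) (f : V -> R) (w : W) :
  open U -> smooth_on U f -> smooth_on U (fun x => f x *: w).
Proof.
move=> oU sf k.
by apply: (Ck_on_linear (L := @scale_vec W w)) (sf k) => //; exact: scalel_continuous.
Qed.

Lemma smooth_sum (W : normedModType R) (U : set V) (I : Type) (r : seq I)
    (f : I -> V -> W) : open U -> (forall i, smooth_on U (f i)) ->
  smooth_on U (fun x => \sum_(i <- r) f i x).
Proof.
move=> oU sf k; elim: r => [|i r IH].
  rewrite (_ : (fun _ => _) = cst 0); first exact: Ck_on_cst.
  by apply/funext => x; rewrite big_nil.
rewrite (_ : (fun _ => _) = f i \+ (fun x => \sum_(j <- r) f j x)).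
  by apply: Ck_onD => //; exact: sf.
by apply/funext => x; rewrite big_cons.
Qed.

Lemma smooth_row n (U : set V) (f : V -> 'rV[R]_n) : open U ->
  (forall j, smooth_on U (fun x => f x 0 j)) -> smooth_on U f.
Proof.
move=> oU sf.
rewrite (_ : f = fun x => \sum_j f x 0 j *: delta_mx 0 j).
  by apply: smooth_sum => // j; exact: smooth_scale.
by apply/funext => x; rewrite -row_sum_delta.
Qed.

Lemma smooth_ext (W : normedModType R) (U : set V) (f g : V -> W) : open U ->
  (forall x, U x -> f x = g x) -> smooth_on U f -> smooth_on U g.
Proof. by move=> oU fg sf k; exact: Ck_on_ext fg (sf k). Qed.

End SmoothCoordinates.

(** * Smooth functions of time and space *)
Section TimeSpace.
Variables (R : realType) (n : nat) (T : set R) (U : set 'rV[R]_n).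
Hypotheses (oT : open T) (oU : open U).

Lemma open_time_space : open (T `*` U).
Proof.
have -> : T `*` U = (@fst R 'rV[R]_n @^-1` T) `&` (@snd R 'rV[R]_n @^-1` U) by [].
apply: openI; apply: open_comp => //= x _; [exact: cvg_fst|exact: cvg_snd].
Qed.

Local Notation K := (smoothfun_on open_time_space).

Definition space_der (k : 'I_n) : {additive K -> K} :=
  smoothfun_derive (0 : R, delta_mx 0 k : 'rV[R]_n).

Definition time_der : {additive K -> K} :=
  smoothfun_derive (1 : R, 0 : 'rV[R]_n).

(** Evaluation respects the unit only at points of the domain, hence the proof
    argument: with it, evaluation is a morphism of rings. *)
Definition at_point (t : R) (y : 'rV[R]_n) (_ : (T `*` U) (t, y)) (a : K) : R :=
  a (t, y).

Section AtPoint.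
Variables (t : R) (y : 'rV[R]_n) (ty : (T `*` U) (t, y)).

Fact at_point_zmod : zmod_morphism (at_point ty).
Proof. by move=> a b; rewrite /at_point smoothfunDE // smoothfunNE. Qed.
HB.instance Definition _ :=
  GRing.isZmodMorphism.Build K R (at_point ty) at_point_zmod.

Fact at_point_monoid : monoid_morphism (at_point ty).
Proof. by split=> [|a b]; rewrite /at_point ?smoothfun1E // smoothfunME. Qed.
HB.instance Definition _ :=
  GRing.isMonoidMorphism.Build K R (at_point ty) at_point_monoid.

End AtPoint.

(** Links time-dependent components, which are total functions with irrelevant
    values outside of the chart, to matrices over the ring. *)
Definition represents m p (X : 'M[K]_(m, p)) (f : R -> 'rV[R]_n -> 'M[R]_(m, p)) :=
  forall t y, T t -> U y -> forall i j, f t y i j = X i j (t, y).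

Lemma derive_space (a : K) (q : 'rV[R]_n -> R) k t y : T t -> U y ->
  (forall z, U z -> q z = a (t, z)) -> pderiv k q y = space_der k a (t, y).
Proof.
move=> Tt Uy qa; rewrite smoothfun_deriveE //.
transitivity ('D_(delta_mx 0 k) (fun z => a (t, z)) y).
  apply: near_eq_derive; have : nbhs y U by exact: open_nbhs_nbhs.
  by apply: filterS => z /qa.
rewrite /derive; set q1 := (fun h : R => _); set q2 := (fun h : R => _).
suff -> : q1 = q2 by [].
apply/funext => h; rewrite /q1 /q2 /=; congr (_ *: (a _ - _)).
by apply: injective_projections => //=; rewrite scaler0 add0r.
Qed.

Lemma is_derive_time (a : K) (q : R -> R) t y : T t -> U y ->
  (forall s, T s -> q s = a (s, y)) -> is_derive t 1 q (time_der a (t, y)).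
Proof.
move=> Tt Uy qa; rewrite smoothfun_deriveE //.
pose e1 : R * 'rV[R]_n := (1, 0); pose c : R * 'rV[R]_n := (0, y).
have lineE s : s *: e1 + c = (s, y).
  apply: injective_projections; first by rewrite /= addr0; exact: mulr1.
  by rewrite /= scaler0 add0r.
apply: (@near_eq_is_derive R R R (fun s => a (s *: e1 + c)) q).
  have : nbhs t T by exact: open_nbhs_nbhs.
  by apply: filterS => z /qa ->; rewrite lineE.
apply: is_derive_line; rewrite lineE; apply: derivableP.
exact: smoothfun_derivable.
Qed.

Lemma derive_time (a : K) (q : R -> R) t y : T t -> U y ->
  (forall s, T s -> q s = a (s, y)) -> derive1 q t = time_der a (t, y).
Proof. by move=> Tt Uy qa; rewrite derive1E; have [] := is_derive_time Tt Uy qa. Qed.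

Lemma represent m p (f : R -> 'rV[R]_n -> 'M[R]_(m, p)) :
  smooth_on (T `*` U) (fun z => f z.1 z.2) -> exists X, represents X f.
Proof.
move=> sf.
exists (\matrix_(i, j) mk_smoothfun open_time_space
  (smooth_entry i j open_time_space sf)).
by move=> t y Tt Uy i j; rewrite mxE mk_smoothfunE.
Qed.

Lemma represent_static m p (f : 'rV[R]_n -> 'M[R]_(m, p)) :
  smooth_on U f -> exists X : 'M[K]_(m, p), represents X (fun=> f) /\
    map_mx time_der X = 0.
Proof.
move=> sf; have sf' : smooth_on (T `*` U) (fun z : R * 'rV[R]_n => f z.2).
  move=> k; apply: (Ck_on_precomp (L := snd)) (sf k); first by move=> x [].
  by move=> x; exact: cvg_snd.
have [X rX] := @represent _ _ (fun=> f) sf'; exists X; split => //.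
apply/matrixP=> i j; rewrite !mxE; apply: smoothfun_ext => -[t y] [Tt Uy].
rewrite -(@derive_time (X i j) (fun=> f y i j)) //; last first.
  by move=> s Ts; exact: (rX _ _ Ts Uy).
by rewrite derive1_cst smoothfun0E.
Qed.

Lemma represents_smooth (X : 'rV[K]_n) (f : R -> 'rV[R]_n -> 'rV[R]_n) :
  represents X f -> smooth_on (T `*` U) (fun z => f z.1 z.2).
Proof.
move=> rX; apply: smooth_row; first exact: open_time_space.
move=> j; apply: smooth_ext (smoothfun_smooth (X 0 j)); first exact: open_time_space.
by move=> [t y] [Tt Uy]; rewrite -rX.
Qed.

End TimeSpace.

(** * Tensor calculus in a chart, evaluated from the ring *)
Section Chart.
Variables (R : realType) (n : nat) (T : set R) (U : set 'rV[R]_n).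
Hypotheses (oT : open T) (oU : open U).
Local Notation K := (smoothfun_on (open_time_space oT oU)).
Local Notation d := (space_der oT oU).
Local Notation dt := (time_der oT oU).

Lemma space_derM k (a b : K) : d k (a * b) = d k a * b + a * d k b.
Proof. exact: smoothfun_deriveM. Qed.
Lemma time_derM (a b : K) : dt (a * b) = dt a * b + a * dt b.
Proof. exact: smoothfun_deriveM. Qed.
Lemma space_derC k l (a : K) : d k (d l a) = d l (d k a).
Proof. exact: smoothfun_deriveC. Qed.
Lemma time_space_derC k (a : K) : dt (d k a) = d k (dt a).
Proof. exact: smoothfun_deriveC. Qed.

Definition constant_fun (c : R) : K := smoothfun_cst _ c.

Lemma constant_funE c t y : T t -> U y -> constant_fun c (t, y) = c.
Proof. by move=> Tt Uy; apply: cutoffE. Qed.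

Lemma space_der_constant k c : d k (constant_fun c) = 0.
Proof.
apply: smoothfun_ext => -[t y] [Tt Uy].
rewrite smoothfun0E // -(@derive_space _ _ _ _ oT oU _ (cst c)) //.
  by rewrite /pderiv derive_cst.
by move=> z Uz; rewrite constant_funE.
Qed.

Lemma half_add_half : constant_fun 2^-1 + constant_fun 2^-1 = 1.
Proof.
apply: smoothfun_ext => -[t y] [Tt Uy].
by rewrite smoothfunDE // smoothfun1E // constant_funE // -[2^-1]mul1r -splitr.
Qed.

(** The inverse is built inside the ring from the adjugate matrix: the
    determinant is a unit because its values do not vanish.  Smoothness of the
    inverse metric comes for free. *)
Lemma represent_metric (G : 'rV[R]_n -> 'M[R]_n) :
  smooth_on U G -> (forall y, U y -> (G y)^T = G y) ->
  (forall y, U y -> G y \in unitmx) ->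
  exists GK HK : 'M[K]_n, [/\ represents GK (fun=> G),
    represents HK (fun=> ginv G), GK^T = GK & GK *m HK = 1%:M].
Proof.
move=> sG Gsym Gunit; have [GK [rG _]] := represent_static oT oU sG.
have evG t y (ty : (T `*` U) (t, y)) : map_mx (at_point ty) GK = G y.
  by apply/matrixP=> i j; rewrite mxE /at_point -rG //; case: ty.
have det0 z : (T `*` U) z -> \det GK z != 0.
  case: z => t y ty.
  rewrite -[\det GK _]/(at_point ty (\det GK)) -det_map_mx evG -unitfE -unitmxE.
  by apply: Gunit; case: ty.
pose dinv := mk_smoothfun (open_time_space oT oU) (fun k =>
  Ck_onV (open_time_space oT oU) det0 (smoothfun_smooth (\det GK) k)).
have dinvE : dinv * \det GK = 1.
  apply: smoothfun_ext => z Uz; rewrite smoothfunME // smoothfun1E //.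
  by rewrite mk_smoothfunE // mulVf // det0.
pose HK := dinv *: \adj GK.
have GH : GK *m HK = 1%:M by rewrite -scalemxAr mul_mx_adj scale_scalar_mx dinvE.
exists GK, HK; split=> //.
  move=> t y Tt Uy i j; rewrite -[HK i j _]/(at_point (conj Tt Uy) (HK i j)).
  have := congr1 (map_mx (at_point (conj Tt Uy))) GH.
  rewrite map_mxM map_mx1 evG => GHy; have Gu := Gunit y Uy.
  rewrite /ginv -[invmx _]mulmx1 -GHy mulmxA mulVmx // mul1mx.
  by rewrite !mxE.
apply/matrixP=> i j; rewrite mxE; apply: smoothfun_ext => -[t y] [Tt Uy].
by rewrite -!rG // -[in LHS]Gsym // mxE.
Qed.

Variables (G : 'rV[R]_n -> 'M[R]_n) (GK HK : 'M[K]_n).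
Hypotheses (rG : represents GK (fun=> G)) (rH : represents HK (fun=> ginv G)).
Hypotheses (Gsym : GK^T = GK) (GH : GK *m HK = 1%:M).

Local Notation h := (constant_fun 2^-1).
Local Notation Gam := (levi_civita d h GK HK).

Lemma christoffelE k i j t y : T t -> U y ->
  christoffel G k i j y = Gam j i k (t, y).
Proof.
move=> Tt Uy; have ty : (T `*` U) (t, y) by [].
have dG l a b : pderiv l (fun z => G z a b) y = d l (GK a b) (t, y).
  by apply: derive_space => // z Uz; rewrite (rG Tt Uz).
rewrite mxE smoothfunME // constant_funE // mxE smoothfun_sumE //; congr (_ * _).
apply: eq_bigr => l _; rewrite smoothfunME // mulrC; congr (_ * _); last first.
  by rewrite (rH Tt Uy) -[in LHS](metric_inverse_sym Gsym GH) mxE.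
rewrite !dG /first_kind !mxE !(smoothfunDE, smoothfunNE) //.
by rewrite [X in X - _]addrC -[in GK i j]Gsym mxE.
Qed.

Lemma covE (u : R -> 'rV[R]_n -> 'rV[R]_n) uK k i t y : represents uK u ->
  T t -> U y -> cov G (u t) k i y = cov_mx d Gam uK i k (t, y).
Proof.
move=> ru Tt Uy; have ty : (T `*` U) (t, y) by [].
rewrite mxE smoothfunDE // mxE summxE smoothfun_sumE //; congr (_ + _).
  by apply: derive_space => // z Uz; rewrite (ru _ _ Tt Uz).
apply: eq_bigr => l _; rewrite mxE smoothfunME // mulrC (ru _ _ Tt Uy).
by rewrite (christoffelE _ _ _ Tt Uy).
Qed.

Lemma represents_nabla w wK u uK : represents wK w -> represents uK u ->
  represents (wK *m cov_mx d Gam uK) (fun t => nabla G (w t) (u t)).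
Proof.
move=> rw ru t y Tt Uy i j; have ty : (T `*` U) (t, y) by [].
rewrite !mxE ord1 smoothfun_sumE //; apply: eq_bigr => l _.
by rewrite smoothfunME // (covE _ _ ru Tt Uy) (rw _ _ Tt Uy).
Qed.

Lemma divergenceE u uK t y : represents uK u -> T t -> U y ->
  divergence G (u t) y = divergence_mx d Gam uK (t, y).
Proof.
move=> ru Tt Uy; have ty : (T `*` U) (t, y) by [].
rewrite /divergence_mx /mxtrace smoothfun_sumE //.
by apply: eq_bigr => l _; exact: covE.
Qed.

Lemma represents_deform u uK : represents uK u ->
  represents (deform_mx d h GK HK uK) (fun t => deform G (u t)).
Proof.
move=> ru t y Tt Uy k j; have ty : (T `*` U) (t, y) by [].
rewrite mxE mx_entryD smoothfunDE // [(HK *m _) k j]mxE [(_^T *m _) k j]mxE.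
rewrite !smoothfun_sumE // -big_split; apply: eq_bigr => i _ /=.
rewrite !(covE _ _ ru Tt Uy) !smoothfunME // !(rH Tt Uy) [(cov_mx _ _ _)^T k i]mxE.
by congr (_ + _); exact: mulrC.
Qed.

Lemma represents_div2 B BK : represents BK B ->
  represents (div2_mx d Gam BK) (fun t => div2 G (B t)).
Proof.
move=> rB t y Tt Uy i j; have ty : (T `*` U) (t, y) by [].
rewrite mxE ord1 summxE smoothfun_sumE //.
have chr := fun a b c => christoffelE a b c Tt Uy.
transitivity (\sum_l (d l (BK l j) (t, y) + (\sum_k Gam l k k (t, y)) * BK l j (t, y)
    + \sum_k BK k l (t, y) * Gam l k j (t, y))).
  rewrite !big_split /=; rewrite -addrA; congr (_ + _).
    apply: eq_bigr => k _; apply: derive_space => // z Uz.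
    by rewrite (rB _ _ Tt Uz).
  rewrite -big_split exchange_big; apply: eq_bigr => l _ /=.
  rewrite mulr_suml -big_split; apply: eq_bigr => k _ /=.
  by rewrite !chr !(rB _ _ Tt Uy); congr (_ + _); exact: mulrC.
apply: eq_bigr => l _; rewrite !mxE !smoothfunDE // smoothfunME // !smoothfun_sumE //.
congr (_ + _ * _ + _).
by apply: eq_bigr => k _; rewrite smoothfunME // [row _ _ _ k]mxE [BK^T l k]mxE.
Qed.

Lemma represents_grad (q : R -> 'rV[R]_n -> R) (a : K) :
  (forall t y, T t -> U y -> q t y = a (t, y)) ->
  represents (grad_mx d HK a) (fun t => grad G (q t)).
Proof.
move=> ra t y Tt Uy i j; have ty : (T `*` U) (t, y) by [].
rewrite !mxE ord1 smoothfun_sumE //; apply: eq_bigr => l _.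
rewrite smoothfunME // !mxE mulrC (rH Tt Uy); congr (_ * _).
by apply: derive_space => // z Uz; rewrite ra.
Qed.

Lemma represents_time_derivative u (uK : 'rV[K]_n) : represents uK u ->
  represents (map_mx dt uK) (fun t y => derive1 (fun s => u s y) t).
Proof.
move=> ru t y Tt Uy i j.
have du a b : is_derive t 1 (fun s => u s y a b) (dt (uK a b) (t, y)).
  by apply: is_derive_time => // s Ts; exact: ru.
rewrite derive1E derive_mx; last by apply/derivable_mxP => a b; have [] := du a b.
by rewrite !mxE; have [] := du i j.
Qed.

Lemma represents_momentum_mx (mu : R) v vK u uK q (a : K) :
  represents vK (fun=> v) -> represents uK u ->
  (forall t y, T t -> U y -> q t y = a (t, y)) ->
  represents (momentum_mx d vK h GK HK dt (constant_fun mu) uK a)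
    (fun t y => derive1 (fun s => u s y) t + nabla G (u t) v y + nabla G v (u t) y
       - mu *: Lop G (u t) y + grad G (q t) y).
Proof.
move=> rv ru ra t y Tt Uy i j; have ty : (T `*` U) (t, y) by [].
rewrite /momentum_mx !(mx_entryD, mx_entryN, mx_entryZ).
rewrite !(smoothfunDE, smoothfunNE) // smoothfunME // constant_funE //.
have -> := represents_time_derivative ru Tt Uy i j.
have -> := represents_nabla ru rv Tt Uy i j.
have -> := represents_nabla rv ru Tt Uy i j.
have -> := represents_div2 (represents_deform ru) Tt Uy i j.
by have -> := represents_grad ra Tt Uy i j.
Qed.

End Chart.

(** An equation that holds at all points of the chart holds in the ring, where it
    can be differentiated. *)
Lemma represents_eq0 (R : realType) n (T : set R) (U : set 'rV[R]_n)
    (oT : open T) (oU : open U) m p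
    (X : 'M[smoothfun_on (open_time_space oT oU)]_(m, p)) f :
  represents X f -> (forall t y, T t -> U y -> f t y = 0) -> X = 0.
Proof.
move=> rX f0; apply/matrixP=> i j; apply: smoothfun_ext => -[t y] [Tt Uy].
by rewrite -rX // f0 // !mxE smoothfun0E.
Qed.

(** The Killing equation and the system are lifted to the ring, [momentum_mx_lie]
    is applied to the vanishing momentum, and the result is evaluated.  The
    pressure [q'] is prescribed on [U] only, because the function on the manifold
    is defined through other charts. *)
Lemma chart_killing_solution (R : realType) n (T : set R) (U : set 'rV[R]_n)
    (G : 'rV[R]_n -> 'M[R]_n) (mu : R) (v : 'rV[R]_n -> 'rV[R]_n)
    (u : R -> 'rV[R]_n -> 'rV[R]_n) (q q' : R -> 'rV[R]_n -> R) :
  open T -> open U -> smooth_on U G ->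
  (forall y, U y -> (G y)^T = G y) -> (forall y, U y -> G y \in unitmx) ->
  smooth_on U v -> (forall y, U y -> deform G v y = 0) ->
  smooth_on (T `*` U) (fun z : R * 'rV[R]_n => u z.1 z.2) ->
  smooth_on (T `*` U) (fun z : R * 'rV[R]_n => q z.1 z.2) ->
  (forall t y, T t -> U y ->
     derive1 (fun s => u s y) t + nabla G (u t) v y + nabla G v (u t) y
       - mu *: Lop G (u t) y + grad G (q t) y = 0
     /\ divergence G (u t) y = 0) ->
  (forall t y, T t -> U y ->
     q' t y = - \sum_k v y 0 k * pderiv k (q t) y) ->
  let u' t y := nabla G (u t) v y - nabla G v (u t) y in
  [/\ smooth_on (T `*` U) (fun z : R * 'rV[R]_n => u' z.1 z.2),
      smooth_on (T `*` U) (fun z : R * 'rV[R]_n => q' z.1 z.2) &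
      forall t y, T t -> U y ->
     derive1 (fun s => u' s y) t + nabla G (u' t) v y + nabla G v (u' t) y
       - mu *: Lop G (u' t) y + grad G (q' t) y = 0
     /\ divergence G (u' t) y = 0].
Proof.
move=> oT oU sG Gsym Gunit sv kill su sq eqs q'E u'.
have [GK [HK [rG rH GKsym GH]]] := represent_metric oT oU sG Gsym Gunit.
have [vK [rv vt]] := represent_static oT oU sv.
have [uK ru] := represent oT oU su.
pose a := mk_smoothfun (open_time_space oT oU) sq.
have ra t y : T t -> U y -> q t y = a (t, y) by move=> Tt Uy; rewrite mk_smoothfunE.
pose d := space_der oT oU; pose h := constant_fun oT oU 2^-1.
have h2 : h + h = 1 := half_add_half oT oU.
have killK : deform_mx d h GK HK vK = 0.
  apply: represents_eq0 (represents_deform rG rH GKsym GH rv) _ => t y _.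
  exact: kill.
have lieG := killing_lie_cov h2 GKsym GH killK.
have lieGam := levi_civita_lie (@space_derM _ _ _ _ oT oU)
  (@space_derC _ _ _ _ oT oU) h2 GKsym GH lieG.
have ru' : represents (- lie_vec d vK uK) u'.
  rewrite -(bracket_lie_vec _ _ h HK GKsym) => t y Tt Uy i j.
  rewrite /u' !(mx_entryD, mx_entryN) smoothfunDE // smoothfunNE //.
  by rewrite (represents_nabla rG rH GKsym GH rv ru Tt Uy)
    (represents_nabla rG rH GKsym GH ru rv Tt Uy).
have ra' t y : T t -> U y -> q' t y = (- dirder d vK a) (t, y).
  move=> Tt Uy; have ty : (T `*` U) (t, y) by [].
  rewrite q'E // smoothfunNE // smoothfun_sumE //; congr (- _).
  apply: eq_bigr => k _; rewrite smoothfunME // (rv _ _ Tt Uy); congr (_ * _).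
  by apply: derive_space => // z Uz; rewrite ra.
have eqK : momentum_mx d vK h GK HK (time_der oT oU) (constant_fun oT oU mu) uK a = 0.
  apply: represents_eq0 (represents_momentum_mx rG rH GKsym GH mu rv ru ra) _.
  by move=> t y Tt Uy; have [] := eqs t y Tt Uy.
have eqK' : momentum_mx d vK h GK HK (time_der oT oU) (constant_fun oT oU mu)
    (- lie_vec d vK uK) (- dirder d vK a) = 0.
  rewrite momentum_mxN (momentum_mx_lie (@space_derM _ _ _ _ oT oU)
    (@space_derC _ _ _ _ oT oU) h2 GKsym GH lieG (@time_derM _ _ _ _ oT oU)
    (@time_space_derC _ _ _ _ oT oU) vt) ?eqK.
    by rewrite lie_vec0 oppr0.
  by move=> k; exact: space_der_constant.
have div0 : divergence_mx d (levi_civita d h GK HK) uK = 0.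
  apply: smoothfun_ext => -[t y] [Tt Uy]; rewrite smoothfun0E //.
  rewrite -(divergenceE rG rH GKsym GH ru Tt Uy).
  by have [] := eqs t y Tt Uy.
split.
- exact: represents_smooth ru'.
- apply: smooth_ext (smoothfun_smooth (- dirder d vK a)).
    exact: open_time_space.
  by move=> [t y] [Tt Uy]; rewrite ra'.
move=> t y Tt Uy; have ty : (T `*` U) (t, y) by []; split.
  apply/matrixP => i j.
  have := represents_momentum_mx rG rH GKsym GH mu rv ru' ra' Tt Uy i j.
  by rewrite eqK' => ->; rewrite !mxE smoothfun0E.
rewrite (divergenceE rG rH GKsym GH ru' Tt Uy).
rewrite /divergence_mx cov_mxN raddfN /= -[\tr _]/(divergence_mx _ _ _).
rewrite (divergence_mx_lie (@space_derM _ _ _ _ oT oU)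
  (@space_derC _ _ _ _ oT oU) lieGam).
by rewrite div0 raddf0 oppr0 smoothfun0E.
Qed.

(** * Derivatives under a change of coordinates *)
Section DirectionalDerivatives.
Variables (R : realType) (n : nat).

Lemma derive_coord (W : normedModType R) (f : 'rV[R]_n -> W) y w :
  differentiable f y -> 'D_w f y = \sum_k w 0 k *: 'D_(delta_mx 0 k) f y.
Proof.
move=> df; rewrite deriveE // [w in LHS]row_sum_delta linear_sum /=.
by apply: eq_bigr => k _; rewrite linearZ deriveE.
Qed.

Lemma derive_row m (f : 'rV[R]_n -> 'rV[R]_m) y w j :
  differentiable f y -> ('D_w f y) 0 j = 'D_w (fun z => f z 0 j) y.
Proof. by move=> df; rewrite derive_mx ?mxE //; exact: diff_derivable. Qed.

Lemma differentiable_entry m (f : 'rV[R]_n -> 'rV[R]_m) y j :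
  differentiable f y -> differentiable (fun z => f z 0 j) y.
Proof.
by move=> df; exact: (differentiable_comp df (differentiable_coord (f y) 0 j)).
Qed.

Lemma jacobianE m (f : 'rV[R]_n -> 'rV[R]_m) y l k :
  differentiable f y -> jacobian f y l k = 'D_(delta_mx 0 l) (fun z => f z 0 k) y.
Proof.
by move=> df; rewrite -derive_row // deriveEjacobian // -rowE [RHS]mxE.
Qed.

Lemma derive_comp_jacobian m (W : normedModType R) (f : 'rV[R]_n -> 'rV[R]_m)
    (q : 'rV[R]_m -> W) y w :
  differentiable f y -> differentiable q (f y) ->
  'D_w (q \o f) y = 'D_(w *m jacobian f y) q (f y).
Proof.
move=> df dq; rewrite !deriveE //; last exact: differentiable_comp.
by rewrite diff_comp //= -deriveEjacobian // deriveE.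
Qed.

(** The symmetry of the Christoffel symbols removes the metric from the bracket,
    so that its transformation law becomes a statement about derivatives. *)
Lemma bracket_coord (U : set 'rV[R]_n) (G : 'rV[R]_n -> 'M[R]_n)
    (u v : 'rV[R]_n -> 'rV[R]_n) y : open U -> U y ->
  (forall z, U z -> (G z)^T = G z) ->
  differentiable u y -> differentiable v y ->
  nabla G u v y - nabla G v u y = 'D_(u y) v y - 'D_(v y) u y.
Proof.
move=> oU Uy Gsym du dv.
have chrC k i j : christoffel G k i j y = christoffel G k j i y.
  rewrite /christoffel; congr (_ * _); apply: eq_bigr => l _; congr (_ * _).
  rewrite [X in X - _ = _]addrC; congr (_ - _); apply: near_eq_derive.
  have : nbhs y U by exact: open_nbhs_nbhs.
  by apply: filterS => z /Gsym {1}<-; rewrite mxE.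
apply/matrixP => i j; rewrite !mx_entryD !mx_entryN !ord1 !derive_row //.
rewrite !derive_coord; [|exact: differentiable_entry..].
rewrite !mxE; under eq_bigr do rewrite mulrDr mulr_sumr.
under [X in _ - X = _]eq_bigr do rewrite mulrDr mulr_sumr.
rewrite !big_split /= opprD addrACA.
rewrite [X in _ + (_ - X)]exchange_big [X in _ + X]addrC.
rewrite [X in _ + X](_ : _ = 0) ?addr0 // addrC; apply/eqP; rewrite subr_eq0; apply/eqP.
by apply: eq_bigr => k _; apply: eq_bigr => l _; rewrite chrC; ring.
Qed.

(** Each of the two terms transforms up to a contraction of [u] and [v] with the
    second derivatives of [f], which is the same for both. *)
Lemma lie_bracket_transform (O : set 'rV[R]_n) (f : 'rV[R]_n -> 'rV[R]_n)
    (u v u' v' : 'rV[R]_n -> 'rV[R]_n) y :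
  open O -> O y -> smooth_on O f ->
  (forall z, O z -> u' (f z) = u z *m jacobian f z) ->
  (forall z, O z -> v' (f z) = v z *m jacobian f z) ->
  differentiable u y -> differentiable v y ->
  differentiable u' (f y) -> differentiable v' (f y) ->
  'D_(u' (f y)) v' (f y) - 'D_(v' (f y)) u' (f y)
  = ('D_(u y) v y - 'D_(v y) u y) *m jacobian f y.
Proof.
move=> oO Oy sf uf vf du dv du' dv'.
have nO : nbhs y O by exact: open_nbhs_nbhs.
have df z : O z -> differentiable f z by have [df _] := sf 1%N; exact: df.
pose J l k z := 'D_(delta_mx 0 l) (fun z => f z 0 k) z.
have sfk k : smooth_on O (fun z => f z 0 k) by exact: smooth_entry.
have dJ l k : differentiable (J l k) y.
  by have [_ /(_ (delta_mx 0 l))[dJ _]] := sfk k 2%N; exact: dJ.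
have transport (w : 'rV[R]_n) (X X' : 'rV[R]_n -> 'rV[R]_n) k :
    (forall z, O z -> X' (f z) = X z *m jacobian f z) ->
    differentiable X y -> differentiable X' (f y) ->
    ('D_(w *m jacobian f y) X' (f y)) 0 k
    = ('D_w X y *m jacobian f y) 0 k
      + \sum_l \sum_m X y 0 l * w 0 m * 'D_(delta_mx 0 m) (J l k) y.
  move=> Xf dX dX'; have dfy := df y Oy.
  rewrite -derive_comp_jacobian // derive_row; last exact: differentiable_comp.
  transitivity ('D_w (\sum_l ((fun z => X z 0 l) * J l k)) y).
    apply: near_eq_derive; move: nO; apply: filterS => z Oz /=.
    rewrite Xf // mxE fct_sumE; apply: eq_bigr => l _.
    by rewrite jacobianE //; exact: df.
  have dXl l : derivable (fun z => X z 0 l) y w.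
    by apply: diff_derivable; exact: differentiable_entry.
  have dJl l : derivable (J l k) y w by exact: diff_derivable.
  rewrite derive_sum; last by move=> l; exact: derivableM.
  rewrite mxE -big_split /=; apply: eq_bigr => l _.
  rewrite deriveM // addrC; congr (_ + _); last first.
    by rewrite jacobianE // derive_row // [LHS]mulrC.
  rewrite derive_coord // scaler_sumr; apply: eq_bigr => m _.
  by rewrite scalerA.
apply/matrixP => i k; rewrite ord1 mx_entryD mx_entryN mulmxBl mx_entryD mx_entryN.
rewrite uf // vf // (transport (u y) v v') // (transport (v y) u u') //.
rewrite [X in _ - (_ + X)]exchange_big /=.
rewrite [X in _ - (_ + X)](_ : _ =
  \sum_l \sum_m v y 0 l * u y 0 m * 'D_(delta_mx 0 m) (J l k) y).
  by rewrite opprD addrACA subrr addr0.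
apply: eq_bigr => l _; apply: eq_bigr => m _.
by rewrite (mulrC (v y 0 l)) /J (schwarz _ _ oO Oy (sfk k 2%N)).
Qed.

End DirectionalDerivatives.

(** * Fields on the manifold *)
Section Manifold.
Variables (R : realType) (n : nat) (M : topologicalType) (A : smooth_atlas R n M).

Definition overlap (i j : A) := cod i `&` param i @^-1` dom j.

Lemma overlap_open i j : open (overlap i j).
Proof.
have := @param_continuous _ _ _ A i.
rewrite continuous_open_subspace; last exact: cod_open.
move=> pc; rewrite openE => y [cy dy]; apply: filterI.
  by apply: open_nbhs_nbhs; split => //; exact: cod_open.
have := pc y; rewrite inE => /(_ cy); apply.
by apply: open_nbhs_nbhs; split => //; exact: dom_open.
Qed.

Lemma transition_cod i j y : overlap i j y -> cod j (transition i j y).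
Proof. by move=> [_ dy]; exact: chart_cod. Qed.

Lemma differentiable_transition i j y :
  overlap i j y -> differentiable (transition i j) y.
Proof. by move=> oy; have [dt _] := @transition_smooth _ _ _ A i j 1%N; exact: dt. Qed.

Lemma smooth_differentiable (V W : normedModType R) (U : set V) (f : V -> W) y :
  smooth_on U f -> U y -> differentiable f y.
Proof. by move=> /(_ 1%N)[df _] /df. Qed.

(** Fields are smooth jointly in time and space; tensor calculus in a chart
    happens at a fixed time. *)
Lemma slice_differentiable (W : normedModType R) (T : set R) (U : set 'rV[R]_n)
    (f : R -> 'rV[R]_n -> W) t y :
  smooth_on (T `*` U) (fun z : R * 'rV[R]_n => f z.1 z.2) -> T t -> U y ->
  differentiable (f t) y.
Proof.
move=> sf Tt Uy.
have dp : differentiable (fun z : 'rV[R]_n => (t, z)) y.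
  by apply: differentiable_pair; [exact: differentiable_cst|].
have df := smooth_differentiable sf (conj Tt Uy : (T `*` U) (t, y)).
exact: (differentiable_comp dp df).
Qed.

Variable g : A -> 'rV[R]_n -> 'M[R]_n.
Hypothesis g_metric : is_riemannian_metric g.

(** A vector in the kernel would have length zero. *)
Lemma metric_unit i y : cod i y -> g i y \in unitmx.
Proof.
move=> cy; have [_ _ gpos _] := g_metric.
rewrite unitmxE unitfE; apply/det0P => -[w w0 wg].
by have := gpos i y cy w w0; rewrite wg mul0mx mxE ltxx.
Qed.

Lemma metric_sym i y : cod i y -> (g i y)^T = g i y.
Proof. by have [_ gsym _ _] := g_metric; exact: gsym. Qed.

(** The metric cancels against its inverse in the gradient. *)
Lemma grad_pairing i (q : 'rV[R]_n -> R) (w : 'rV[R]_n) y : cod i y ->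
  (grad (g i) q y *m g i y *m w^T) 0 0 = \sum_k w 0 k * pderiv k q y.
Proof.
move=> cy; have gu := metric_unit cy.
have -> : grad (g i) q y = (\row_k pderiv k q y) *m invmx (g i y).
  apply/matrixP=> a b; rewrite !mxE; apply: eq_bigr => k _.
  rewrite /ginv mxE mulrC; congr (_ * _).
  by rewrite -[g i y in LHS]metric_sym // -trmx_inv mxE.
rewrite mulmxKV // mxE; apply: eq_bigr => k _.
by rewrite !mxE mulrC.
Qed.

(** The left-hand side is computed in the chart chosen at the point; by the chain
    rule and the transformation law of [v], the derivative of [p] along [v] is
    the same in the chart [i]. *)
Lemma metric_pair_grad (v : A -> 'rV[R]_n -> 'rV[R]_n) (p : M -> R) i y :
  vector_law v -> (forall (j : A) z, cod j z -> differentiable (p \o param j) z) ->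
  cod i y ->
  metric_pair g (grad_field g p) v (param i y)
  = \sum_k v i y 0 k * pderiv k (p \o param i) y.
Proof.
move=> vlaw dp cy; rewrite /metric_pair; set j := chart_at A _.
have dj : dom j (param i y) by rewrite /j /chart_at; case: cid.
have oy : overlap i j y by [].
have tc := transition_cod oy; rewrite -/(transition i j y) in tc *.
rewrite grad_pairing //.
have dE (k : A) (w z : 'rV[R]_n) : cod k z ->
    \sum_l w 0 l * pderiv l (p \o param k) z = 'D_w (p \o param k) z.
  by move=> cz; rewrite derive_coord //; exact: dp.
rewrite !dE // vlaw // -derive_comp_jacobian; last 2 first.
- exact: differentiable_transition.
- exact: dp.
apply: near_eq_derive.
have : nbhs y (overlap i j) by apply: open_nbhs_nbhs; split=> //; exact: overlap_open.
by apply: filterS => z [_ dz] /=; rewrite chartK.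
Qed.

Lemma bracket_vector_law (u v : A -> 'rV[R]_n -> 'rV[R]_n) :
  vector_law u -> vector_law v ->
  (forall (i : A) z, cod i z -> differentiable (u i) z) ->
  (forall (i : A) z, cod i z -> differentiable (v i) z) ->
  vector_law (bracket g u v).
Proof.
move=> ul vl du dv i j y cy dy; have oy : overlap i j y by [].
have tc := transition_cod oy.
have bE k z : cod k z ->
    bracket g u v k z = 'D_(u k z) (v k) z - 'D_(v k z) (u k) z.
  move=> cz; rewrite /bracket; apply: (bracket_coord _ cz).
  - exact: cod_open.
  - by move=> *; exact: metric_sym.
  - exact: du.
  - exact: dv.
rewrite !bE //.
apply: (@lie_bracket_transform R n (overlap i j)) => //.
- exact: overlap_open.
- exact: transition_smooth.
- by move=> z [cz dz]; exact: ul.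
- by move=> z [cz dz]; exact: vl.
- exact: du.
- exact: dv.
- exact: du.
- exact: dv.
Qed.

End Manifold.

Theorem theorem6p1 (R : realType) (n : nat) (M : topologicalType)
    (A : smooth_atlas R n M)
    (M_compact : compact [set: M]) (M_hausdorff : hausdorff_space M)
    (g : A -> 'rV[R]_n -> 'M[R]_n) (g_metric : is_riemannian_metric g)
    (mu : R)
    (v : A -> 'rV[R]_n -> 'rV[R]_n) (v_killing : is_killing g v)
    (T : set R) (T_open : open T) (T_interval : is_interval T)
    (u : R -> A -> 'rV[R]_n -> 'rV[R]_n) (p : R -> M -> R)
    (up_solution : is_solution g T mu v u p) :
  is_solution g T mu v
    (fun t => bracket g (u t) v)
    (fun t x => - metric_pair g (grad_field g (p t)) v x).
Proof.
have [[sv vlaw] kill] := v_killing; have [[su ulaw] sp eqs] := up_solution.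
have [sg gsym _ _] := g_metric.
have du t i : T t -> forall z, cod i z -> differentiable (u t i) z.
  move=> Tt z cz.
  exact: (slice_differentiable (f := fun s => u s i) (su i)).
have dp t (i : A) : T t -> forall z, cod i z -> differentiable (p t \o param i) z.
  move=> Tt z cz.
  exact: (slice_differentiable (f := fun s => p s \o param i) (sp i)).
have dv i z : cod i z -> differentiable (v i) z.
  by move=> cz; exact: smooth_differentiable (sv i) cz.
have sol (i : A) := chart_killing_solution
  (q' := fun t y => - metric_pair g (grad_field g (p t)) v (param i y))
  T_open (@cod_open _ _ _ A i) (sg i) (gsym i) (metric_unit g_metric (i := i))
  (sv i) (kill i) (su i) (sp i) (fun t y Tt cy => eqs t Tt i y cy)
  (fun t y Tt cy =>
     congr1 -%R (metric_pair_grad g_metric vlaw (fun j => dp t j Tt) cy)).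
split.
- split=> [i|t Tt]; first by have [] := sol i.
  exact: (bracket_vector_law g_metric (ulaw t Tt) vlaw (fun i z => @du t i Tt z) dv).
- by move=> i; have [] := sol i.
- by move=> t Tt i y cy; have [_ _] := sol i; exact.
Qed.
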